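(* Let $K=\mathbb{Q}(\sqrt{-d})$ with $d\in\{1,3,7,11\}$, let $\mathcal{O}_K$ be its ring of integers and $\Gamma=\mathrm{SL}_2(\mathcal{O}_K)$ acting on $\mathbb{C}^2$ by left matrix multiplication. Suppose a continued fraction algorithm for approximating an arbitrary complex number by elements of $K$ exists whose denominators $q_n$ satisfy, for all sufficiently large $n$: (1) $|q_{n+1}|>|q_n|$, and (2) $|q_{n+r_0}|\ge \theta|q_n|$ for some fixed $r_0\in\mathbb{N}$ and $\theta>1$. Then for every $\mathbf{z}=(z_1,z_2)^t\in\mathbb{C}^2$ with $z_1/z_2\in\mathbb{C}\setminus K$ and $\omega_K(z_1/z_2)=1$ (a full measure subset of $\mathbb{C}^2$): (i) $\mu_\Gamma(\mathbf{z},\mathbf{0})=\hat\mu_\Gamma(\mathbf{z},\mathbf{0})=1$; (ii) for almost all target points $\mathbf{y}=(y_1,y_2)^t$ whose slope $y=y_1/y_2$ lies in $\mathbb{C}\setminus K$ and satisfies $\omega_K(y)=1$, \[\tfrac13\le \hat\mu_\Gamma(\mathbf{z},\mathbf{y})\le \mu_\Gamma(\mathbf{z},\mathbf{y})\le \tfrac12;\] (iii) for all target points $\mathbf{y}$ whose slope $y_1/y_2$ lies in $K$, $\mu_\Gamma(\mathbf{z},\mathbf{y})=\hat\mu_\Gamma(\mathbf{z},\mathbf{y})=\tfrac12$.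
   Context: For a matrix or vector $A$ with complex entries, $|A|$ denotes the maximum of the moduli of its entries; for $z\in\mathbb{C}$, $|z|$ is the usual modulus. The slope of $\mathbf{z}=(z_1,z_2)^t$ is $z_1/z_2$. A continued fraction algorithm assigns to a complex number $z\notin K$ a sequence of partial quotients $a_n\in\mathcal{O}_K$ ($n\ge0$); the convergents $p_n/q_n$ are defined by $p_{-2}=0,p_{-1}=1,p_n=a_np_{n-1}+p_{n-2}$ and $q_{-2}=1,q_{-1}=0,q_n=a_nq_{n-1}+q_{n-2}$, and $p_n/q_n\to z$. For $z\in\mathbb{C}\setminus K$, the $K$-irrationality measure $\omega_K(z)$ is the supremum of all $\omega$ such that $|qz-p|\le |q|^{-\omega}$ has infinitely many solutions $p\in\mathcal{O}_K$, $q\in\mathcal{O}_K\setminus\{0\}$. For $\mathbf{z},\mathbf{y}\in\mathbb{C}^2$, $\mu_\Gamma(\mathbf{z},\mathbf{y})$ is the supremum of all $\omega$ such that $|\gamma\mathbf{z}-\mathbf{y}|\le|\gamma|^{-\omega}$ has infinitely many solutions $\gamma\in\Gamma$, and $\hat\mu_\Gamma(\mathbf{z},\mathbf{y})$ is the supremum of all $\omega$ such that the system $|\gamma\mathbf{z}-\mathbf{y}|\le T^{-\omega}$, $|\gamma|\le T$ has a solution $\gamma\in\Gamma$ for all sufficiently large $T$. ''Almost all'' refers to Lebesgue measure on $\mathbb{C}^2\cong\mathbb{R}^4$. *)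

(* Defs.v *)
From HB Require Import structures.
From mathcomp Require Import all_boot all_order all_algebra.
From mathcomp Require Import all_classical all_reals all_analysis.
From mathcomp Require Import complex.

Set Implicit Arguments.
Unset Strict Implicit.
Unset Printing Implicit Defensive.

Import Order.TTheory GRing.Theory Num.Theory.
Import numFieldNormedType.Exports.

Local Open Scope classical_set_scope.
Local Open Scope ring_scope.
Local Open Scope complex_scope.

(* The modulus of a complex number as an element of R; the norm `|z| of R[i]
   takes its values in R[i]. *)
Definition cmod (R : realType) (z : R[i]) : R := Normc.normc z.

Definition max_norm (R : realType) m n (A : 'M[R[i]]_(m, n)) : R :=
  \big[Num.max/0]_(ij : 'I_m * 'I_n) cmod (A ij.1 ij.2).

(* Since 1 / 0 = 0 here, this is meaningful only if the second coordinate is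
   nonzero. *)
Definition slope (R : realType) (v : 'cV[R[i]]_2) : R[i] := v 0 0 / v 1 0.

(* Q(sqrt(-d)), as a subset of the complex numbers *)
Definition quadK (R : realType) (d : nat) : set R[i] :=
  [set z | exists a b : rat, z = ratr a +i* (ratr b * Num.sqrt d%:R)].

Definition ringOK (R : realType) (d : nat) : set R[i] :=
  [set z | quadK d z /\ integralOver (intr : int -> R[i]) z].

Definition SL2OK (R : realType) (d : nat) : set 'M[R[i]]_2 :=
  [set g : 'M[R[i]]_2 | (forall i j, ringOK d (g i j)) /\ \det g = 1].

(* cf_rec a u v n is the pair (s_{n-2}, s_{n-1}), where s_{-2} = u, s_{-1} = v
   and s_n = a_n s_{n-1} + s_{n-2}. *)
Fixpoint cf_rec (R : realType) (a : nat -> R[i]) (u v : R[i]) (n : nat) :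
    R[i] * R[i] :=
  if n is m.+1 then
    let s := cf_rec a u v m in (s.2, a m * s.2 + s.1)
  else (u, v).

Definition cf_num (R : realType) (a : nat -> R[i]) (n : nat) : R[i] :=
  (cf_rec a 0 1 n.+1).2.

Definition cf_den (R : realType) (a : nat -> R[i]) (n : nat) : R[i] :=
  (cf_rec a 1 0 n.+1).2.

(* a z n is the n-th partial quotient of z; the values a z for z in K are
   irrelevant. *)
Definition cf_algorithm (R : realType) (d : nat) (a : R[i] -> nat -> R[i]) :
    Prop :=
  forall z, ~ quadK d z ->
    (forall n, ringOK d (a z n)) /\
    (fun n => cmod (cf_num (a z) n / cf_den (a z) n - z)) @ \oo --> (0 : R).

Definition omegaK (R : realType) (d : nat) (z : R[i]) : \bar R :=
  ereal_sup [set w%:E | w in [set w : R |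
    infinite_set [set pq : R[i] * R[i] |
      [/\ ringOK d pq.1, ringOK d pq.2, pq.2 != 0 &
          cmod (pq.2 * z - pq.1) <= cmod pq.2 `^ (- w)]]]].

Definition muG (R : realType) (d : nat) (z y : 'cV[R[i]]_2) : \bar R :=
  ereal_sup [set w%:E | w in [set w : R |
    infinite_set [set g : 'M[R[i]]_2 |
      SL2OK d g /\ max_norm (g *m z - y) <= max_norm g `^ (- w)]]].

Definition hat_muG (R : realType) (d : nat) (z y : 'cV[R[i]]_2) : \bar R :=
  ereal_sup [set w%:E | w in [set w : R |
    \forall T \near +oo, exists g : 'M[R[i]]_2,
      [/\ SL2OK d g, max_norm (g *m z - y) <= T `^ (- w) & max_norm g <= T]]].

(* the identification of R^4 with C^2 *)
Definition vecC2 (R : realType) (x : R * R * R * R) : 'cV[R[i]]_2 :=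
  let: (x1, x2, x3, x4) := x in
  \col_i (if i == 0 then x1 +i* x2 else x3 +i* x4).

Definition lebR4 (R : realType) :
    {measure set (measurableTypeR R * measurableTypeR R *
                  measurableTypeR R * measurableTypeR R)%type -> \bar R} :=
  (@lebesgue_measure R \x @lebesgue_measure R \x
   @lebesgue_measure R \x @lebesgue_measure R)%E.

(* P holds for Lebesgue-almost every vector of C^2. *)
Definition ae_C2 (R : realType) (P : 'cV[R[i]]_2 -> Prop) : Prop :=
  {ae lebR4 R, forall x, P (vecC2 x)}.

Definition generic_slope (R : realType) (d : nat) (v : 'cV[R[i]]_2) : Prop :=
  [/\ v 1 0 != 0, ~ quadK d (slope v) & omegaK d (slope v) = 1%:E].

(* Main.v *)
(** Write xi = z_1 / z_2 and let v_k = (q_k, -p_k) be the rows given by the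
    convergents of xi. The growth hypotheses give |v_k z| <= C / |q_(k+1)|, and
    omega_K(xi) = 1 gives |v z| >= c |v|^(-1-eps) for every nonzero integral row v.
    - A matrix with second row v_k and first row v_(k-1) + n v_k, with n rounded
      in O_K, sends z to within C / |q_(k+1)| of any prescribed (t, 0), at a cost
      of about |t| |q_k|^(2+eps) in norm. Taking t = 0, or moving (t, 0) to a target
      of slope in K, or to a convergent of the slope of a generic target, gives the
      lower exponents 1, 1/2 and 1/3.
    - If the target is (t, 0), then Cramer's rule forces the second row v to have
      norm at most C |gamma|^(1-w); with the lower bound for |v z| this gives
      w <= 1/2.
    - For almost every target, w <= 1/2 follows from the Borel-Cantelli lemma: a
      gamma with gamma z bounded is determined by its first row and a multiple of
      that row, and the sum of |gamma|^(-s) over such gamma converges for s > 2. *)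

Require Import Defs.
From HB Require Import structures.
From mathcomp Require Import all_boot all_order all_algebra all_field.
From mathcomp Require Import all_classical all_reals all_analysis.
From mathcomp Require Import complex.
From mathcomp Require Import measurable_realfun ring lra.

Set Implicit Arguments.
Unset Strict Implicit.
Unset Printing Implicit Defensive.

Import Order.TTheory GRing.Theory Num.Theory.
Import numFieldNormedType.Exports.

Local Open Scope classical_set_scope.
Local Open Scope ring_scope.
Local Open Scope complex_scope.

(** Origin of the exponents, up to eps: a matrix of norm X^2 |t| + X moves z to within 1 / X of (t,
    0), which gives 1 for t = 0 and 1/2 for a fixed t. For a generic target, a matrix M of norm Y
    built from convergents of its slope sends some (t, 0) with |t| about 1 / Y to within Y^(-2) of
    it. The product M gamma then has norm X^2 + X Y and error Y / X + Y^(-2); at the balance the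
    error is X^(-2/3) for norm X^2, whence 1/3. From above, the ball of radius |gamma|^(-w) in C^2
    has measure of order |gamma|^(-4 w), which is summable once 4 w > 2. Comparing the two exponents
    meets an obstacle: if gamma z = y, this single gamma solves the uniform system for every w and
    all large T, but adds only one solution to the count behind mu. Hence each kind of target is
    shown to avoid the orbit of z; for almost every y this holds because the orbit is countable. *)

Section ComplexModulus.
Variable R : realType.
Implicit Types x y z : R[i].

Lemma cmod0 : cmod (0 : R[i]) = 0. Proof. exact: Normc.normc0. Qed.
Lemma cmod1 : cmod (1 : R[i]) = 1. Proof. exact: Normc.normc1. Qed.
Lemma cmodM x y : cmod (x * y) = cmod x * cmod y.
Proof. exact: Normc.normcM. Qed.
Lemma cmodV x : cmod x^-1 = (cmod x)^-1. Proof. exact: Normc.normcV. Qed.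
Lemma cmodN x : cmod (- x) = cmod x. Proof. exact: normcN. Qed.
Lemma cmodD x y : cmod (x + y) <= cmod x + cmod y.
Proof. exact: le_normcD. Qed.
Lemma cmod_ge0 x : 0 <= cmod x.
Proof. by case: x => a b; rewrite /cmod /=; exact: sqrtr_ge0. Qed.
Lemma cmod_eq0 x : (cmod x == 0) = (x == 0).
Proof. by apply/eqP/eqP => [/Normc.eq0_normc|->]; rewrite ?cmod0. Qed.
Lemma cmod_gt0 x : (0 < cmod x) = (x != 0).
Proof. by rewrite lt_neqAle eq_sym cmod_eq0 cmod_ge0 andbT. Qed.
Lemma cmodB x y : cmod (x - y) = cmod (y - x).
Proof. by rewrite -cmodN opprB. Qed.
Lemma cmodB_le x y : cmod x - cmod y <= cmod (x - y).
Proof. by rewrite lerBlDr -{1}(subrK y x) cmodD. Qed.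
Lemma sqr_cmod x : cmod x ^+ 2 = complex.Re x ^+ 2 + complex.Im x ^+ 2.
Proof. by case: x => a b; rewrite /cmod /= sqr_sqrtr // addr_ge0 ?sqr_ge0. Qed.
Lemma Re_le_cmod x : `|complex.Re x| <= cmod x.
Proof.
rewrite -(@ler_pXn2r _ 2) ?nnegrE ?cmod_ge0 // sqr_cmod real_normK ?num_real //.
by rewrite lerDl sqr_ge0.
Qed.
Lemma Im_le_cmod x : `|complex.Im x| <= cmod x.
Proof.
rewrite -(@ler_pXn2r _ 2) ?nnegrE ?cmod_ge0 // sqr_cmod real_normK ?num_real //.
by rewrite lerDr sqr_ge0.
Qed.
End ComplexModulus.

Section MaxNorm.
Variable R : realType.

Lemma max_norm_ge m n (A : 'M[R[i]]_(m, n)) i j : cmod (A i j) <= max_norm A.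
Proof.
rewrite /max_norm.
exact: (@le_bigmax _ _ _ 0 (fun ij : 'I_m * 'I_n => cmod (A ij.1 ij.2)) (i, j)).
Qed.

Lemma max_norm_ge0 m n (A : 'M[R[i]]_(m, n)) : 0 <= max_norm A.
Proof. by rewrite /max_norm; exact: bigmax_ge_id. Qed.

Lemma max_norm_le m n (A : 'M[R[i]]_(m, n)) B :
  0 <= B -> (forall i j, cmod (A i j) <= B) -> max_norm A <= B.
Proof. by move=> B0 AB; apply: bigmax_le => // ij _; exact: AB. Qed.

End MaxNorm.

(** * Rational algebraic integers *)

Section RationalIntegers.
Variable R : realType.

(** The integral equation has integer coefficients, so it can be read over any field of
    characteristic 0: it is moved from [R[i]] to [rat] and then to [algC], where rational algebraic
    integers are known to be integers. *)
Lemma rat_integral_int (a : rat) :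
  integralOver (intr : int -> R[i]) ((ratr a : R)%:C) ->
  exists m : int, a = m%:~R.
Proof.
case=> p mp rp.
have ra : root (map_poly (intr : int -> rat) p) a.
  have -> : root (map_poly (intr : int -> rat) p) a =
    root (map_poly (real_complex R) (map_poly ratr (map_poly intr p)))
         ((ratr a : R)%:C).
    by rewrite !fmorph_root.
  rewrite -!map_poly_comp; congr (root _ _): rp; apply: eq_map_poly => n /=.
  by rewrite !rmorph_int.
have aint : (ratr a : algC) \in Num.int.
  apply: Cint_rat_Aint; first exact: Crat_rat.
  apply: (@root_monic_Aint (map_poly (intr : int -> algC) p)).
  - have -> : map_poly (intr : int -> algC) p =
      map_poly ratr (map_poly (intr : int -> rat) p).
      by rewrite -map_poly_comp; apply: eq_map_poly => n /=; rewrite rmorph_int.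
    by rewrite fmorph_root.
  - exact: monic_map.
  - by apply/polyOverP => i; rewrite coef_map; exact: intr_int.
move/intrP: aint => [m /eqP]; rewrite -(rmorph_int (@ratr algC)) => /eqP/fmorph_inj ->.
by exists m.
Qed.

End RationalIntegers.

(** * The ring of integers of K: discreteness, coordinates and Euclidean rounding *)

Section RingOfIntegers.
Variables (R : realType) (d : nat).
Implicit Types x y z : R[i].
Local Notation rd := (Num.sqrt (d%:R : R)).

Lemma sqr_sqrt_nat : rd ^+ 2 = d%:R.
Proof. by rewrite sqr_sqrtr // ler0n. Qed.

Lemma quadKD x y : quadK d x -> quadK d y -> quadK d (x + y).
Proof.
move=> [a [b ->]] [a' [b' ->]]; exists (a + a'), (b + b').
by rewrite !rmorphD /= mulrDl.
Qed.

Lemma quadKN x : quadK d x -> quadK d (- x).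
Proof. by move=> [a [b ->]]; exists (- a), (- b); rewrite !rmorphN /= mulNr. Qed.

Lemma quadKM x y : quadK d x -> quadK d y -> quadK d (x * y).
Proof.
move=> [a [b ->]] [a' [b' ->]].
exists (a * a' - b * b' * d%:R), (a * b' + b * a').
have rE := sqr_sqrt_nat; set r := rd in rE *.
rewrite rmorphB rmorphD !rmorphM /= ratr_nat -rE.
by rewrite -[LHS]/(_ +i* _); congr (_ +i* _); ring.
Qed.

Lemma quadKV x : quadK d x -> quadK d x^-1.
Proof.
move=> [a [b ->]]; pose N := a ^+ 2 + b ^+ 2 * d%:R.
exists (a / N), (- b / N).
have NE : (ratr N : R) = ratr a ^+ 2 + (ratr b * rd) ^+ 2.
  by rewrite /N [(_ * rd) ^+ 2]exprMn sqr_sqrt_nat rmorphD (rmorphM _ (b ^+ 2)) !rmorphXn /= ratr_nat.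
rewrite -[LHS]/(_ -i* _) !fmorph_div rmorphN /= NE.
by congr (_ +i* _); ring.
Qed.

Lemma quadK_int (m : int) : quadK d (m%:~R : R[i]).
Proof.
exists m%:~R, 0; rewrite rmorph_int rmorph0 mul0r.
by rewrite -(rmorph_int (real_complex R)).
Qed.

Lemma ringOK_int (m : int) : ringOK d (m%:~R : R[i]).
Proof. by split; [exact: quadK_int | exact: integral_id]. Qed.

Lemma ringOK0 : ringOK d (0 : R[i]). Proof. exact: (ringOK_int 0). Qed.
Lemma ringOK1 : ringOK d (1 : R[i]). Proof. exact: (ringOK_int 1). Qed.

Lemma ringOKD x y : ringOK d x -> ringOK d y -> ringOK d (x + y).
Proof. by move=> [? ?] [? ?]; split; [exact: quadKD | exact: integral_add]. Qed.

Lemma ringOKN x : ringOK d x -> ringOK d (- x).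
Proof. by move=> [? ?]; split; [exact: quadKN | exact: integral_opp]. Qed.

Lemma ringOKB x y : ringOK d x -> ringOK d y -> ringOK d (x - y).
Proof. by move=> ? /ringOKN; exact: ringOKD. Qed.

Lemma ringOKM x y : ringOK d x -> ringOK d y -> ringOK d (x * y).
Proof. by move=> [? ?] [? ?]; split; [exact: quadKM | exact: integral_mul]. Qed.

Lemma ringOK_sqrtN : ringOK d (0 +i* rd : R[i]).
Proof.
split; first by exists 0, 1; rewrite rmorph0 rmorph1 mul1r.
exists ('X ^+ 2 + (d%:R)%:P).
  by rewrite monicE lead_coefDl ?lead_coefXn // size_polyXn size_polyC; case: (_ != _).
rewrite rmorphD /= map_polyXn map_polyC /= rootE !hornerE rmorph_nat.
have -> : (0 +i* rd : R[i]) ^+ 2 = - d%:R.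
  have rE := sqr_sqrt_nat; set r := rd in rE *.
  rewrite -(rmorph_nat (real_complex R)) -rE expr2.
  rewrite -[LHS]/(_ +i* _) -[RHS]/(_ +i* _); congr (_ +i* _); ring.
by rewrite addNr.
Qed.

(** A root of X^2 - X + k. The hypothesis says that d is 3 modulo 4, as are 3, 7 and 11. *)
Lemma ringOK_half_sqrtN k : (4 * k = d.+1)%N ->
  ringOK d (2^-1 +i* (rd / 2) : R[i]).
Proof.
move=> kd; split.
  by exists 2^-1, 2^-1; rewrite fmorphV /= ratr_nat mulrC.
exists ('X ^+ 2 + (k%:R%:P - 'X)).
  rewrite monicE lead_coefDl ?lead_coefXn // size_polyXn.
  rewrite -opprB size_polyN size_XsubC //.
rewrite !rmorphD rmorphN /= map_polyXn map_polyX map_polyC /= rootE !hornerE rmorph_nat.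
apply/eqP; rewrite -(rmorph_nat (real_complex R)).
have kR : k%:R = (d%:R + 1) / 4 :> R.
  apply: (@mulfI _ 4); first by rewrite pnatr_eq0.
  by rewrite -natrM kd -natr1 mulrC divfK // pnatr_eq0.
have rE := sqr_sqrt_nat; set r := rd in rE *.
rewrite kR -rE expr2.
rewrite -[LHS]/(_ +i* _) -[RHS]/(_ +i* _); by congr (_ +i* _); field.
Qed.

Lemma integral_conj x : integralOver (intr : int -> R[i]) x ->
  integralOver (intr : int -> R[i]) x^*%C.
Proof.
move=> /(integral_rmorph (@conjc R)).
suff -> : (conjc \o (intr : int -> R[i])) = intr by [].
by apply/funext => m /=; rewrite rmorph_int.
Qed.

(** The product of x and its conjugate is integral and rational. All discreteness arguments start
    here: |x| >= 1 for x nonzero, Euclidean descent, the growth of |q_n| and the choice of shortest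
    rows. *)
Lemma ringOK_cmod_sqr x : ringOK d x -> exists k : nat, cmod x ^+ 2 = k%:R.
Proof.
move=> [[a [b ->]]] ix.
have : integralOver (intr : int -> R[i]) ((ratr (a ^+ 2 + b ^+ 2 * d%:R) : R)%:C).
  have := integral_mul ix (integral_conj ix).
  suff -> : (ratr a +i* (ratr b * rd)) * (ratr a +i* (ratr b * rd))^*%C
     = (ratr (a ^+ 2 + b ^+ 2 * d%:R) : R)%:C by [].
  have rE := sqr_sqrt_nat; set r := rd in rE *.
  rewrite rmorphD rmorphM !rmorphXn /= ratr_nat -rE.
  by rewrite -[LHS]/(_ +i* _); congr (_ +i* _); ring.
move=> /rat_integral_int [m Em].
have H : cmod (ratr a +i* (ratr b * rd)) ^+ 2 = m%:~R :> R.
  rewrite sqr_cmod /= [(ratr b * _) ^+ 2]exprMn sqr_sqrt_nat -(rmorph_int (@ratr R)) -Em.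
  by rewrite rmorphD (rmorphM _ (b ^+ 2)) !rmorphXn /= ratr_nat.
have m0 : 0 <= m by rewrite -(ler0z R) -H sqr_ge0.
by exists `|m|%N; rewrite H -{1}(gez0_abs m0).
Qed.

Lemma ringOK_cmod_ge1 x : ringOK d x -> x != 0 -> 1 <= cmod x.
Proof.
move=> /ringOK_cmod_sqr [k Hk] x0.
rewrite -(@ler_pXn2r _ 2) ?nnegrE ?cmod_ge0 ?ler01 // expr1n Hk ler1n lt0n.
apply/eqP => k0; move: Hk; rewrite k0 => /eqP.
by rewrite expf_eq0 /= cmod_eq0 (negbTE x0).
Qed.

(** The traces of x and of sqrt(-d) x are rational integers, which bounds the denominators of both
    coordinates. This places O_K inside a lattice, the form in which finiteness, countability and
    summation over O_K are obtained. *)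
Lemma ringOK_coord x : (0 < d)%N -> ringOK d x ->
  exists m n : int, x = (m%:~R / 2) +i* (n%:~R / (2 * rd)).
Proof.
move=> d0 rx; have [[a [b xE]] ix] := rx.
have rd0 : rd != 0 by rewrite sqrtr_eq0 -ltNge ltr0n.
have trace y : integralOver (intr : int -> R[i]) y ->
    integralOver (intr : int -> R[i]) ((2 * complex.Re y)%:C).
  move=> iy; suff -> : ((2 * complex.Re y)%:C) = y + y^*%C
    by apply: integral_add => //; exact: integral_conj.
  by case: y {iy} => u v; rewrite -[RHS]/(_ +i* _); congr (_ +i* _) => /=; ring.
have [m Em] : exists m : int, 2 * a = m%:~R.
  apply: (@rat_integral_int R); move: (trace _ ix).
  by rewrite xE /= (rmorphM (@ratr R)) /= ratr_nat.
have [n En] : exists n : int, - (2 * (b * d%:R)) = n%:~R.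
  apply: (@rat_integral_int R).
  have := trace _ (ringOKM ringOK_sqrtN rx).2; rewrite xE /=.
  have rE := sqr_sqrt_nat; set r := rd in rE *.
  rewrite (rmorphN (@ratr R)) !(rmorphM (@ratr R)) /= !ratr_nat -rE.
  suff -> : 2 * (0 * ratr a - r * (ratr b * r)) =
    - (2 * (ratr b * r ^+ 2)) by [].
  by ring.
exists m, (- n); rewrite xE; congr (_ +i* _).
  by rewrite -(rmorph_int (@ratr R)) -Em rmorphM /= ratr_nat; field.
rewrite rmorphN /= -(rmorph_int (@ratr R)) -En rmorphN !rmorphM /= !ratr_nat.
have rE := sqr_sqrt_nat; set r := rd in rd0 rE *.
by rewrite -rE; field.
Qed.

Lemma quadK_fracP z : quadK d z ->
  exists p q : R[i], [/\ ringOK d p, ringOK d q, q != 0 & z = p / q].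
Proof.
move=> [a [b ->]].
have qn0 (u : rat) : (denq u)%:~R != 0 :> R[i] by rewrite intr_eq0 denq_neq0.
exists ((numq a)%:~R * (denq b)%:~R +
        (numq b)%:~R * (denq a)%:~R * (0 +i* rd)), ((denq a)%:~R * (denq b)%:~R).
split; last 1 first.
- apply: (canRL (mulfK _)); first by rewrite mulf_neq0.
  have ratE (u : rat) : (ratr u : R)%:C * (denq u)%:~R = (numq u)%:~R :> R[i].
    rewrite -(rmorph_int (real_complex R)) -(rmorph_int (real_complex R) (numq u)).
    rewrite -rmorphM /=; congr (_%:C).
    by rewrite /ratr divfK // intr_eq0 denq_neq0.
  rewrite -!ratE.
  have -> : ratr a +i* (ratr b * rd) = (ratr a)%:C + (ratr b)%:C * (0 +i* rd) :> R[i].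
    by rewrite -[RHS]/(_ +i* _); congr (_ +i* _); ring.
  by ring.
- apply: ringOKD; first by apply: ringOKM; exact: ringOK_int.
  apply: ringOKM; last exact: ringOK_sqrtN.
  by apply: ringOKM; exact: ringOK_int.
- by apply: ringOKM; exact: ringOK_int.
- by rewrite mulf_neq0.
Qed.

Lemma round_int (x : R) : exists m : int, `|x - m%:~R| <= 2^-1.
Proof.
exists (Num.floor (x + 2^-1)).
have /andP[] := floor_itv (x + 2^-1); rewrite rmorphD /= => h1 h2.
rewrite ler_norml; apply/andP; split; lra.
Qed.

(** For d = 1 rounding both coordinates leaves a squared error of at most 1/4 + 1/4. Otherwise the
    basis 1, (1 + sqrt(-d)) / 2 leaves at most 1/4 + d / 16 <= 15/16. *)
Lemma ringOK_euclid z : d \in [:: 1; 3; 7; 11]%N ->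
  exists n, ringOK d n /\ cmod (z - n) < 1.
Proof.
move=> hd; case: z => a b.
have sq_half (t : R) : `|t| <= 2^-1 -> t ^+ 2 <= 4^-1.
  move=> ht; rewrite -real_normK ?num_real //.
  have -> : 4^-1 = 2^-1 ^+ 2 :> R by field.
  by rewrite ler_pXn2r ?nnegrE ?invr_ge0.
have lt1 w : cmod w ^+ 2 < 1 -> cmod w < 1 :> R.
  by rewrite expr_lt1 ?cmod_ge0.
have [d1|d1] := eqVneq d 1%N.
  have [m hm] := round_int a; have [n hn] := round_int b.
  exists (m%:~R + n%:~R * (0 +i* rd)); split.
    by apply: ringOKD; [|apply: ringOKM; last exact: ringOK_sqrtN]; exact: ringOK_int.
  apply: lt1; rewrite sqr_cmod d1 sqrtr1.
  rewrite -!(rmorph_int (real_complex R)) /=.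
  move: (sq_half _ hm) (sq_half _ hn); rewrite !mul0r !mulr0 !mulr1 !addr0 subr0 add0r.
  lra.
have [k [kd d11]] : exists k, (4 * k = d.+1)%N /\ (d <= 11)%N.
  move: hd; rewrite !inE (negbTE d1) /= => /or3P[] /eqP ->.
  - by exists 1%N.
  - by exists 2%N.
  - by exists 3%N.
have rd0 : rd != 0.
  rewrite sqrtr_eq0 -ltNge ltr0n; move: hd; rewrite !inE.
  by move=> /or4P[] /eqP ->.
(* The imaginary part is rounded first, because n (1 + sqrt(-d)) / 2 also shifts the real part by n
   / 2. *)
have [n hn] := round_int (2 * b / rd).
have [m hm] := round_int (a - n%:~R / 2).
exists (m%:~R + n%:~R * (2^-1 +i* (rd / 2))); split.
  by apply: ringOKD; [|apply: ringOKM; last exact: ringOK_half_sqrtN kd]; exact: ringOK_int.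
apply: lt1; rewrite sqr_cmod -!(rmorph_int (real_complex R)) /=.
have -> : a - (m%:~R + (n%:~R * 2^-1 - 0 * (rd / 2))) = a - n%:~R / 2 - m%:~R by ring.
have -> : b - (0 + (n%:~R * (rd / 2) + 0 * 2^-1)) = rd / 2 * (2 * b / rd - n%:~R).
  by field.
rewrite exprMn expr_div_n sqr_sqrt_nat.
have d11R : d%:R <= 11 :> R by rewrite ler_nat.
have d0R : 0 <= d%:R :> R by rewrite ler0n.
move: (sq_half _ hm) (sq_half _ hn) (sqr_ge0 (2 * b / rd - n%:~R)).
set u := (_ ^+ 2); set v := (_ ^+ 2) => hu hv v0.
have : d%:R / 2 ^+ 2 * v <= 11 / 4 * 4^-1.
  by apply: ler_pM => //; lra.
lra.
Qed.

End RingOfIntegers.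

(** * Two by two matrices over O_K: finiteness of balls and completion of columns *)

Section SpecialLinear.
Variables (R : realType) (d : nat).
Implicit Types (x y : R[i]) (g : 'M[R[i]]_2) (v : 'cV[R[i]]_2).

Definition mat2 (a b c e : R[i]) : 'M[R[i]]_2 :=
  \matrix_(i, j) if i == 0 then (if j == 0 then a else b)
                 else if j == 0 then c else e.

Lemma ord2P (P : 'I_2 -> Prop) : P 0 -> P 1 -> forall i, P i.
Proof.
by move=> P0 P1 [[|[|//]] lti]; [have -> : Ordinal lti = 0 by apply: val_inj
  | have -> : Ordinal lti = 1 by apply: val_inj].
Qed.

Lemma mat2E a b c e : (mat2 a b c e 0 0 = a) * (mat2 a b c e 0 1 = b) *
  (mat2 a b c e 1 0 = c) * (mat2 a b c e 1 1 = e).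
Proof. by rewrite !mxE. Qed.

Lemma mat2_eta g : g = mat2 (g 0 0) (g 0 1) (g 1 0) (g 1 1).
Proof. by apply/matrixP; apply: ord2P; apply: ord2P; rewrite mat2E. Qed.

Lemma det2E g : \det g = g 0 0 * g 1 1 - g 0 1 * g 1 0.
Proof.
rewrite (expand_det_row _ 0) !big_ord_recl big_ord0 addr0 /cofactor !det_mx11 !mxE /=.
have -> : lift 0 (0 : 'I_1) = (1 : 'I_2) by apply: val_inj.
have -> : lift (1 : 'I_2) (0 : 'I_1) = (0 : 'I_2) by apply: val_inj.
by rewrite /= expr0 mul1r expr1 mulN1r mulrN.
Qed.

Lemma mulmx2E m g (A : 'M[R[i]]_(2, m)) i j :
  (g *m A) i j = g i 0 * A 0 j + g i 1 * A 1 j.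
Proof.
rewrite mxE !big_ord_recl big_ord0 addr0.
by have -> : lift 0 (0 : 'I_1) = (1 : 'I_2) by apply: val_inj.
Qed.

Lemma max_norm_mul m g (A : 'M[R[i]]_(2, m)) :
  max_norm (g *m A) <= 2 * max_norm g * max_norm A.
Proof.
apply: max_norm_le => [|i j]; first by rewrite !mulr_ge0 // max_norm_ge0.
rewrite mulmx2E (le_trans (cmodD _ _)) // !cmodM mulr_natl mulr2n mulrDl.
by apply: lerD; apply: ler_pM; rewrite ?cmod_ge0 ?max_norm_ge.
Qed.

Lemma max_normD m n (A B : 'M[R[i]]_(m, n)) :
  max_norm (A + B) <= max_norm A + max_norm B.
Proof.
apply: max_norm_le => [|i j]; first by rewrite addr_ge0 // max_norm_ge0.
by rewrite mxE (le_trans (cmodD _ _)) // lerD // max_norm_ge.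
Qed.

Lemma max_norm_mat2 a b c e B : 0 <= B -> cmod a <= B -> cmod b <= B ->
  cmod c <= B -> cmod e <= B -> max_norm (mat2 a b c e) <= B.
Proof.
move=> B0 ha hb hc he; apply: max_norm_le => //.
by apply: ord2P; apply: ord2P; rewrite mat2E.
Qed.

Lemma SL2OK_mat2 a b c e : ringOK d a -> ringOK d b -> ringOK d c ->
  ringOK d e -> a * e - b * c = 1 -> SL2OK d (mat2 a b c e).
Proof.
move=> ha hb hc he h; split; last by rewrite det2E !mat2E.
by apply: ord2P; apply: ord2P; rewrite mat2E.
Qed.

Lemma SL2OK_det g : SL2OK d g -> g 0 0 * g 1 1 - g 0 1 * g 1 0 = 1.
Proof. by move=> [_]; rewrite det2E. Qed.

Lemma SL2OK_mul g h : SL2OK d g -> SL2OK d h -> SL2OK d (g *m h).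
Proof.
move=> [rg dg] [rh dh]; split; last by rewrite det_mulmx dg dh mulr1.
by move=> i j; rewrite mulmx2E; apply: ringOKD; apply: ringOKM.
Qed.

Lemma SL2OK_norm_ge1 g : SL2OK d g -> 1 <= max_norm g.
Proof.
move=> hg; have [rg _] := hg; have dg := SL2OK_det hg.
have ge1 i j : g i j != 0 -> 1 <= max_norm g.
  by move=> gij; rewrite (le_trans (ringOK_cmod_ge1 (rg i j) gij)) // max_norm_ge.
have [g00|/ge1//] := eqVneq (g 0 0) 0.
apply: (ge1 0 1); apply/eqP => g01; move: dg.
by rewrite g00 g01 !mul0r subr0 => /eqP; rewrite eq_sym oner_eq0.
Qed.

Lemma finite_int_ball (B : R) : finite_set [set m : int | `|m%:~R : R| <= B].
Proof.
have [N hN] : exists N : nat, B < N%:R.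
  by exists (Num.truncn B).+1; exact: truncnS_gt.
apply: (@sub_finite_set _ _ ((fun k : nat => k%:Z - N%:Z) @` `I_(N + N).+1)).
  move=> m /= hm.
  have : `|m| < N%:Z.
    by rewrite -(ltr_int R) intr_norm (le_lt_trans hm).
  rewrite ltr_norml => /andP[h1 h2].
  exists (absz (m + N%:Z)); last first.
    by rewrite gez0_abs ?addrK // -lerBlDr sub0r ltW.
  rewrite /= ltnS -lez_nat gez0_abs; last by rewrite -lerBlDr sub0r ltW.
  by rewrite PoszD lerD2r ltW.
by apply: finite_image; exact: finite_II.
Qed.

Lemma finite_ringOK_ball (B : R) : (0 < d)%N ->
  finite_set [set x | ringOK d x /\ cmod x <= B].
Proof.
move=> d0; have rd0 : (0 : R) < 2 * Num.sqrt d%:R.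
  by rewrite mulr_gt0 // sqrtr_gt0 ltr0n.
apply: (@sub_finite_set _ _ ((fun mn : int * int =>
    (mn.1%:~R / 2) +i* (mn.2%:~R / (2 * Num.sqrt d%:R))) @`
  ([set m : int | `|m%:~R : R| <= B * 2] `*`
   [set m : int | `|m%:~R : R| <= B * (2 * Num.sqrt d%:R)]))); last first.
  by apply: finite_image; apply: finite_setX; exact: finite_int_ball.
move=> x [/= rx hx]; have [m [n xE]] := ringOK_coord d0 rx.
exists (m, n) => //=; split => /=.
- rewrite -ler_pdivrMr // -{1}[2]gtr0_norm // -normf_div.
  by apply: le_trans hx; rewrite xE (le_trans _ (Re_le_cmod _)).
- rewrite -ler_pdivrMr // -{1}[2 * _]gtr0_norm // -normf_div.
  by apply: le_trans hx; rewrite xE (le_trans _ (Im_le_cmod _)).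
Qed.

Lemma finite_SL2OK_ball (B : R) : (0 < d)%N ->
  finite_set [set g | SL2OK d g /\ max_norm g <= B].
Proof.
move=> d0; have fin := finite_ringOK_ball B d0.
apply: (@sub_finite_set _ _ ((fun t : R[i] * R[i] * R[i] * R[i] =>
  mat2 t.1.1.1 t.1.1.2 t.1.2 t.2) @`
  ([set x | ringOK d x /\ cmod x <= B] `*` [set x | ringOK d x /\ cmod x <= B]
   `*` [set x | ringOK d x /\ cmod x <= B]
   `*` [set x | ringOK d x /\ cmod x <= B]))); last first.
  by apply: finite_image; do 3!apply: finite_setX => //.
move=> g [[rg _] hg]; exists (g 0 0, g 0 1, g 1 0, g 1 1); last first.
  by rewrite /= -mat2_eta.
by do !split => //=; apply: le_trans hg; exact: max_norm_ge.
Qed.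

(* This is where the class number one of K enters, through the Euclidean
   algorithm of its ring of integers. *)
Lemma SL2OK_column x y : d \in [:: 1; 3; 7; 11]%N -> ringOK d x -> ringOK d y ->
  exists g t, [/\ SL2OK d g, x = g 0 0 * t & y = g 1 0 * t].
Proof.
move=> hd rx ry; have [k ky] := ringOK_cmod_sqr ry.
elim/ltn_ind: k x y rx ry ky => k IH x y rx ry ky.
have [y0|y0] := eqVneq y 0.
  exists (mat2 1 0 0 1), x; rewrite !mat2E; split; rewrite ?mul1r ?mul0r //.
  apply: SL2OK_mat2; rewrite ?mul0r ?mulr1 ?subr0 //;
    by [exact: ringOK0 | exact: ringOK1].
have [n [rn hn]] := ringOK_euclid (x / y) hd.
pose r := x - n * y.
have rr : ringOK d r by apply: ringOKB => //; exact: ringOKM.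
have [l rl] := ringOK_cmod_sqr rr.
have rE : r = (x / y - n) * y by rewrite mulrBl divfK.
have lk : (l < k)%N.
  rewrite -(ltr_nat R) -rl -ky ltr_pXn2r ?nnegrE ?cmod_ge0 // rE cmodM.
  by rewrite gtr_pMl // cmod_gt0.
(* The division step is (x, y) -> (-y, x - n y); the sign gives it determinant 1, so the descent
   stays in SL_2. *)
have [g [t [hg yg rg]]] := IH _ lk _ _ (ringOKN ry) rr rl.
have [og _] := hg; have dg := SL2OK_det hg.
exists (mat2 (g 1 0 - n * g 0 0) (g 1 1 - n * g 0 1) (- g 0 0) (- g 0 1)), t.
rewrite !mat2E; split.
- apply: SL2OK_mat2; rewrite -?dg; last by ring.
  + by apply: ringOKB => //; exact: ringOKM.
  + by apply: ringOKB => //; exact: ringOKM.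
  + exact: ringOKN.
  + exact: ringOKN.
- by rewrite mulrBl -rg -mulrA -yg /r; ring.
- by rewrite mulNr -yg opprK.
Qed.

End SpecialLinear.

(** * What the growth hypotheses give: convergents with controlled error *)

Section Convergents.
Variables (R : realType) (d : nat).

Lemma cf_rec_ringOK (a : nat -> R[i]) u v n : (forall n, ringOK d (a n)) ->
  ringOK d u -> ringOK d v ->
  ringOK d (cf_rec a u v n).1 /\ ringOK d (cf_rec a u v n).2.
Proof.
move=> ra ru rv; elim: n => [//|n [IH1 IH2]] /=; split=> //.
by apply: ringOKD => //; exact: ringOKM.
Qed.

Lemma cf_rec_det (a : nat -> R[i]) n :
  (cf_rec a 0 1 n).2 * (cf_rec a 1 0 n).1 -
  (cf_rec a 0 1 n).1 * (cf_rec a 1 0 n).2 = (-1) ^+ n.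
Proof.
elim: n => [|n IH] /=; first by rewrite !mulr0 mulr1 subr0.
by rewrite exprS -IH; ring.
Qed.

(** The increments 1 / (|q_n| |q_(n+1)|) decrease by a factor theta^2 over r0 steps, and each block
    of r0 increments is at most r0 times its first one. So C is the solution of C = r0 + C /
    theta^2. The bound is uniform in k and thus survives the limit k -> oo. *)
Lemma convergents_cauchy (p q : nat -> R[i]) (r0 : nat) (theta : R) :
  1 < theta -> (forall n, q n != 0) ->
  (forall n, cmod (q n) < cmod (q n.+1)) ->
  (forall n, theta * cmod (q n) <= cmod (q (n + r0)%N)) ->
  (forall n, cmod (p n * q n.+1 - q n * p n.+1) = 1) ->
  exists2 C : R, 0 < C & forall k n,
    cmod (p (n + k)%N / q (n + k)%N - p n / q n) <=
    C / (cmod (q n) * cmod (q n.+1)).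
Proof.
move=> th q0 qS qr dpq.
have Q0 n : 0 < cmod (q n) by rewrite cmod_gt0.
have qmono m n : (m <= n)%N -> cmod (q m) <= cmod (q n).
  elim: n => [|n IH]; first by rewrite leqn0 => /eqP ->.
  rewrite leq_eqVlt => /orP[/eqP -> //|/IH h].
  by rewrite (le_trans h) // ltW.
have step n : cmod (p n.+1 / q n.+1 - p n / q n) = (cmod (q n) * cmod (q n.+1))^-1.
  have -> : p n.+1 / q n.+1 - p n / q n =
      - (p n * q n.+1 - q n * p n.+1) / (q n * q n.+1).
    by field; rewrite !q0.
  by rewrite cmodM cmodN dpq mul1r cmodV cmodM.
have th0 : 0 < theta by rewrite (lt_trans _ th).
have th2 : 1 < theta ^+ 2 by rewrite exprn_egt1.
have r0gt : (0 < r0)%N.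
  rewrite lt0n; apply/eqP => r00; move: (qr 0%N).
  by rewrite r00 addn0 leNgt ltr_pMl // th.
pose C := r0%:R * theta ^+ 2 / (theta ^+ 2 - 1).
have C0 : 0 < C.
  by rewrite divr_gt0 ?subr_gt0 // mulr_gt0 ?ltr0n // exprn_gt0.
have CE : r0%:R + C / theta ^+ 2 = C.
  rewrite /C; field.
  by rewrite !gt_eqF // ?subr_gt0.
have short k n : cmod (p (n + k)%N / q (n + k)%N - p n / q n) <=
    k%:R / (cmod (q n) * cmod (q n.+1)).
  elim: k => [|k IH]; first by rewrite addn0 subrr cmod0 mul0r.
  rewrite -(subrKA (p (n + k)%N / q (n + k)%N)) (le_trans (cmodD _ _)) //.
  rewrite -natr1 mulrDl addrC lerD // addnS step mul1r lef_pV2 ?posrE ?mulr_gt0 //.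
  by apply: ler_pM; rewrite ?cmod_ge0 ?qmono ?ltnS ?leq_addr.
exists C => // k; elim/ltn_ind: k => k IH n.
have D0 : 0 < (cmod (q n) * cmod (q n.+1))^-1 by rewrite invr_gt0 mulr_gt0.
have [kr|rk] := leqP k r0.
  rewrite (le_trans (short k n)) // ler_pM2r // (@le_trans _ _ r0%:R) ?ler_nat //.
  by rewrite -CE lerDl divr_ge0 ?ltW // exprn_gt0.
rewrite -(subnKC (ltnW rk)) addnA.
rewrite -(subrKA (p (n + r0)%N / q (n + r0)%N)) (le_trans (cmodD _ _)) //.
rewrite -{1}CE mulrDl addrC lerD //.
apply: le_trans (IH _ _ _) _; first by rewrite ltn_subrL r0gt (leq_ltn_trans _ rk).
rewrite -[X in _ <= X]mulrA ler_pM2l // -invfM lef_pV2 ?posrE ?mulr_gt0 //.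
rewrite expr2 mulrACA -addSn.
by apply: ler_pM; rewrite ?mulr_ge0 ?cmod_ge0 ?qr ?ltW.
Qed.

(** All that later arguments retain of a continued fraction: a tail of its convergents, with signs
    adjusted so that consecutive rows have determinant 1. The bound n <= |q_n|^2 makes the
    denominators unbounded in an explicit way. *)
Definition convergent_seq (xi : R[i]) (C : R) (p q : nat -> R[i]) : Prop :=
  forall n,
  [/\ ringOK d (p n), ringOK d (q n), 1 <= cmod (q n) &
      cmod (q n) < cmod (q n.+1)] /\
  [/\ p n * q n.+1 - q n * p n.+1 = 1,
      cmod (q n * xi - p n) <= C / cmod (q n.+1) &
      n%:R <= cmod (q n) ^+ 2].

Definition has_convergents : Prop := forall xi : R[i], ~ quadK d xi ->
  exists C p q, 0 < C /\ convergent_seq xi C p q.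

Lemma has_convergents_of_cf (a : R[i] -> nat -> R[i]) (r0 : nat) (theta : R) :
  cf_algorithm d a -> 1 < theta ->
  (forall z : R[i], ~ quadK d z -> \forall n \near \oo,
     cmod (cf_den (a z) n) < cmod (cf_den (a z) n.+1) /\
     theta * cmod (cf_den (a z) n) <= cmod (cf_den (a z) (n + r0)%N)) ->
  has_convergents.
Proof.
move=> cfa th growth xi Kxi; have [ra cvg_a] := cfa _ Kxi.
have [N _ hN] := growth _ Kxi.
(* The shift by N + 1 instead of N makes [q 0] nonzero too: its modulus exceeds that of the
   preceding denominator. *)
pose p n := cf_num (a xi) (N.+1 + n)%N; pose q n := cf_den (a xi) (N.+1 + n)%N.
have rp n : ringOK d (p n).
  by apply: (cf_rec_ringOK _ ra _ _).2; [exact: ringOK0 | exact: ringOK1].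
have rq n : ringOK d (q n).
  by apply: (cf_rec_ringOK _ ra _ _).2; [exact: ringOK1 | exact: ringOK0].
have qS n : cmod (q n) < cmod (q n.+1).
  by rewrite /q addnS; apply: (hN _ _).1; rewrite /= addSn leqW // leq_addr.
have qr n : theta * cmod (q n) <= cmod (q (n + r0)%N).
  by rewrite /q addnA; apply: (hN _ _).2; rewrite /= addSn leqW // leq_addr.
have q0 n : q n != 0.
  rewrite -cmod_gt0 (le_lt_trans (cmod_ge0 (cf_den (a xi) (N + n)%N))) //.
  by rewrite /q addSn; apply: (hN _ _).1; rewrite /= leq_addr.
pose e n := p n * q n.+1 - q n * p n.+1.
have ee n : e n * e n = 1.
  have -> : e n = - (-1) ^+ (N.+1 + n).+2.
    by rewrite -(cf_rec_det (a xi)) /e /p /q /cf_num /cf_den addnS /=; ring.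
  by rewrite mulrNN -expr2 sqrr_sign.
have re n : ringOK d (e n) by apply: ringOKB; exact: ringOKM.
have sqr1_cmod (x : R[i]) : x * x = 1 -> cmod x = 1.
  move=> /(congr1 (@cmod R)); rewrite cmodM cmod1 -expr2 => /eqP.
  by rewrite sqrp_eq1 ?cmod_ge0 // => /eqP.
have [C C0 hC] := convergents_cauchy th q0 qS qr (fun n => sqr1_cmod _ (ee n)).
have lim_bound n : cmod (xi - p n / q n) <= C / (cmod (q n) * cmod (q n.+1)).
  apply/ler_addgt0Pr => eps eps0.
  have /cvgrPdist_lt/(_ eps eps0) [M _ hM] := cvg_a.
  have := hM (N.+1 + (n + M))%N; rewrite /= => /(_ _).
  rewrite sub0r normrN ger0_norm ?cmod_ge0 // -/(p _) -/(q _) => hlim.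
  rewrite -(subrKA (p (n + M)%N / q (n + M)%N)) (le_trans (cmodD _ _)) //.
  rewrite addrC lerD ?hC // cmodB ltW // hlim //.
  by rewrite addnA leq_addl.
(* The determinants [e n] are signs. Since s_n s_(n+1) = e_n, scaling p_n and q_n by s_n turns every
   determinant into 1. *)
pose s n := \prod_(i < n) e i.
have sS n : s n.+1 = s n * e n by rewrite /s big_ord_recr.
have ss n : s n * s n = 1.
  elim: n => [|n IH]; first by rewrite /s big_ord0 mulr1.
  by rewrite sS mulrACA IH ee mulr1.
have rs n : ringOK d (s n).
  elim: n => [|n IH]; first by rewrite /s big_ord0; exact: ringOK1.
  by rewrite sS; exact: ringOKM.
have cs n x : cmod (s n * x) = cmod x by rewrite cmodM sqr1_cmod // mul1r.
exists C, (fun n => s n * p n), (fun n => s n * q n); split=> // n.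
rewrite !cs; split; split=> //; try exact: ringOKM.
- exact: ringOK_cmod_ge1.
- by rewrite sS -[RHS](mulr1 1) -{1}(ss n) -(ee n) {3}/e; ring.
- rewrite -mulrA -mulrBr cs.
  have -> : q n * xi - p n = q n * (xi - p n / q n) by field; exact: q0.
  rewrite cmodM (le_trans (ler_wpM2l (cmod_ge0 _) (lim_bound n))) //.
  have Q0 m : cmod (q m) != 0 by rewrite cmod_eq0.
  by rewrite le_eqVlt; apply/orP; left; apply/eqP; field; rewrite !Q0.
(* The |q_n|^2 are strictly increasing natural numbers. *)
- elim: n => [|n IH]; first by rewrite exprn_ge0 ?cmod_ge0.
  have [k kE] := ringOK_cmod_sqr (rq n); have [l lE] := ringOK_cmod_sqr (rq n.+1).
  have : cmod (q n) ^+ 2 < cmod (q n.+1) ^+ 2 by rewrite ltr_pXn2r ?nnegrE ?cmod_ge0.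
  by move: IH; rewrite kE lE ler_nat ltr_nat ler_nat => /leq_ltn_trans; apply.
Qed.

End Convergents.

(** * Real powers and positive minima over finite sets *)

Section RealPowers.
Variable R : realType.
Implicit Types x y r s : R.

Lemma powR_gt0D x r s : 0 < x -> x `^ (r + s) = x `^ r * x `^ s.
Proof. by move=> x0; rewrite powRD // (lt0r_neq0 x0) implybT. Qed.

Lemma le_powR2r x y r : 0 <= r -> 0 <= x -> x <= y -> x `^ r <= y `^ r.
Proof.
by move=> r0 x0 xy; apply: ge0_ler_powR; rewrite ?nnegrE // (le_trans x0).
Qed.

Lemma le_powRN2r x y r : 0 <= r -> 0 < x -> x <= y -> y `^ (- r) <= x `^ (- r).
Proof.
move=> r0 x0 xy; rewrite !powRN lef_pV2 ?posrE ?powR_gt0 // ?(lt_le_trans x0) //.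
by rewrite le_powR2r // ltW.
Qed.

Lemma powR_ge1 x r : 1 <= x -> 0 <= r -> 1 <= x `^ r.
Proof. by move=> x1 r0; rewrite -(powRr0 x) ler_powR. Qed.

Lemma powRVK x r : 0 < x -> r != 0 -> (x `^ r^-1) `^ r = x.
Proof. by move=> x0 r0; rewrite -powRrM mulVf // powRr1 // ltW. Qed.

Lemma powRV x r : 0 <= x -> (x^-1) `^ r = (x `^ r)^-1.
Proof. by move=> x0; rewrite -[x^-1]powR_inv1 // -powRrM mulN1r powRN. Qed.

Lemma near_powR_ge r (M : R) : 0 < r -> \forall T \near +oo, M <= T `^ r.
Proof.
move=> r0; near=> T.
have [M0|M0] := leP M 0; first by rewrite (le_trans M0) ?powR_ge0.
rewrite -(powRVK M0 (lt0r_neq0 r0)); apply: le_powR2r; rewrite ?powR_ge0 1?ltW //.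
Unshelve. all: by end_near. Qed.

Lemma finite_set_pos_min (T : Type) (F : set T) (f : T -> R) : finite_set F ->
  (forall u, F u -> 0 < f u) -> exists2 c, 0 < c & forall u, F u -> c <= f u.
Proof.
move=> finF f0.
have [B hB] : exists B, forall u, F u -> (f u)^-1 <= B.
  have /finite_seqP[s sE] := finite_image (fun u => (f u)^-1) finF.
  exists (\big[Num.max/0]_(y <- s) y) => x Fx.
  have : [set` s] (f x)^-1 by rewrite -sE; exists x.
  by move=> xs; exact: (le_bigmax_seq 0 _ xpredT id xs).
exists (Num.max 1 B)^-1; first by rewrite invr_gt0 lt_max ltr01.
move=> x Fx; rewrite -[f x]invrK lef_pV2 ?posrE ?invr_gt0 ?f0 ?lt_max ?ltr01 //.
by rewrite le_max hB // orbT.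
Qed.

End RealPowers.

(** * Lower bound for the linear form at a generic vector *)

Section LowerBound.
Variables (R : realType) (d : nat) (z : 'cV[R[i]]_2).
Hypothesis gz : generic_slope d z.

Lemma generic_coord_neq0 : z 1 0 != 0. Proof. by case: gz. Qed.

Lemma row_dotE (a b : R[i]) : a * z 0 0 + b * z 1 0 = z 1 0 * (a * slope z + b).
Proof. by rewrite /slope; field; exact: generic_coord_neq0. Qed.

Lemma omegaK_finite (xi : R[i]) (w : R) : omegaK d xi = 1%:E -> 1 < w ->
  finite_set [set pq : R[i] * R[i] | [/\ ringOK d pq.1, ringOK d pq.2,
    pq.2 != 0 & cmod (pq.2 * xi - pq.1) <= cmod pq.2 `^ (- w)]].
Proof.
move=> hom w1; apply: contrapT => hinf.
have : (w%:E <= omegaK d xi)%E by apply: ereal_sup_ubound; exists w.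
by rewrite hom lee_fin leNgt w1.
Qed.

(** Since omega_K is 1, only finitely many (p, q) satisfy |q xi - p| <= |q|^(-1-eps); their forms
    are nonzero because xi is not in K, so a constant absorbs them. Rows with a = 0 have |b| >= 1. A
    free bound B in place of the norm of the row suits callers that only have an estimate of it. *)
Lemma generic_lower (eps : R) : 0 < eps -> exists2 c : R, 0 < c &
  forall a b B, ringOK d a -> ringOK d b -> (a, b) != (0, 0) ->
    cmod a <= B -> cmod b <= B -> 1 <= B ->
    c * B `^ (- (1 + eps)) <= cmod (a * z 0 0 + b * z 1 0).
Proof.
move=> eps0; have [z1 Kz omz] := gz.
have e1 : 1 < 1 + eps by rewrite ltrDl.
have e0 : 0 <= 1 + eps by rewrite addr_ge0 // ltW.
have [|c0 c00 hc0] := @finite_set_pos_min _ _ _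
  (fun pq : R[i] * R[i] => cmod (pq.2 * slope z - pq.1)) (omegaK_finite omz e1).
  move=> [p q] /= [[Kp _] [Kq _] q0 _]; rewrite cmod_gt0; apply/eqP => h.
  apply: Kz; have -> : slope z = p / q.
    by apply: (canRL (mulfK q0)); apply/eqP; rewrite -subr_eq0 mulrC h.
  by apply: quadKM => //; exact: quadKV.
pose m := Num.min 1 c0; have m0 : 0 < m by rewrite lt_min ltr01.
exists (cmod (z 1 0) * m); first by rewrite mulr_gt0 // cmod_gt0.
move=> a b B ra rb ab aB bB B1.
have B0 : 0 < B by rewrite (lt_le_trans _ B1).
have powB1 : B `^ (- (1 + eps)) <= 1.
  by rewrite (le_trans (le_powRN2r e0 ltr01 B1)) // powR1.
rewrite row_dotE cmodM -mulrA ler_wpM2l ?cmod_ge0 //.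
have [a0|a0] := eqVneq a 0.
  move: ab; rewrite a0 xpair_eqE eqxx /= mul0r add0r => b0.
  rewrite (le_trans _ (ringOK_cmod_ge1 rb b0)) //.
  by rewrite -[leRHS](mulr1 1) ler_pM ?powR_ge0 ?(ltW m0) // ge_min lexx.
have a1 := ringOK_cmod_ge1 ra a0.
have aB' : B `^ (- (1 + eps)) <= cmod a `^ (- (1 + eps)).
  by rewrite le_powRN2r // (lt_le_trans _ a1).
have [h|h] := leP (cmod (a * slope z + b)) (cmod a `^ (- (1 + eps))).
  have := hc0 (- b, a); rewrite /= opprK => /(_ _)/(le_trans _); apply; last first.
    split=> //; exact: ringOKN.
  by rewrite -[leRHS]mulr1 ler_pM ?powR_ge0 ?(ltW m0) // ge_min lexx orbT.
apply: le_trans (ltW h); rewrite (le_trans _ aB') //.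
by rewrite -[leRHS]mul1r ler_wpM2r ?powR_ge0 // ge_min lexx.
Qed.

End LowerBound.

(** * From a family of approximations to the uniform exponent *)

Section HatExponent.
Variables (R : realType) (d : nat).
Implicit Types z y : 'cV[R[i]]_2.

Definition hat_approximable z y (w : R) : Prop :=
  \forall T \near +oo, exists g : 'M[R[i]]_2,
    [/\ SL2OK d g, max_norm (g *m z - y) <= T `^ (- w) & max_norm g <= T].

(** Take X with C X^A = T. The error is then a constant times T^(-B/A), and the strict gap B / A - w
    > 0 absorbs the constant for large T. *)
Lemma hat_approximableP z y (A B C X0 w : R) : 0 < A -> 0 < C -> w * A < B ->
  (forall X, X0 <= X -> exists2 g : 'M[R[i]]_2, SL2OK d g &
     max_norm g <= C * X `^ A /\ max_norm (g *m z - y) <= C * X `^ (- B)) ->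
  hat_approximable z y w.
Proof.
move=> A0 C0 wAB H.
have e0 : 0 < B / A - w by rewrite subr_gt0 ltr_pdivlMr.
have Ain0 : 0 < A^-1 by rewrite invr_gt0.
near=> T.
have T0 : 0 < T by [].
have [|g hg [h1 h2]] := H ((T / C) `^ A^-1).
  rewrite powRM ?invr_ge0 ?(ltW C0) ?(ltW T0) //.
  rewrite -ler_pdivrMr ?powR_gt0 ?invr_gt0 //.
  by near: T; exact: near_powR_ge.
have TC0 : 0 < T / C by rewrite divr_gt0.
exists g; split=> //; last first.
  by rewrite (le_trans h1) // powRVK ?lt0r_neq0 // mulrC divfK ?lt0r_neq0.
apply: (le_trans h2); rewrite -powRrM powRM ?invr_ge0 ?(ltW C0) ?(ltW T0) //.
have -> : T `^ (- w) = T `^ (A^-1 * - B) * T `^ (B / A - w).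
  by rewrite -powR_gt0D //; congr (_ `^ _); field; rewrite gt_eqF.
rewrite mulrCA ler_wpM2l ?powR_ge0 //.
by near: T; exact: near_powR_ge.
Unshelve. all: by end_near. Qed.

End HatExponent.

(** * Moving z close to a prescribed point (t, 0) *)

Section Approximation.
Variables (R : realType) (d : nat) (hd : d \in [:: 1; 3; 7; 11]%N).
Implicit Types (t : R[i]) (z y : 'cV[R[i]]_2).

Definition col2 (a b : R[i]) : 'cV[R[i]]_2 := \col_i if i == 0 then a else b.

Lemma col2E a b : (col2 a b 0 0 = a) * (col2 a b 1 0 = b).
Proof. by rewrite !mxE. Qed.

Lemma max_norm_col (v : 'cV[R[i]]_2) B : 0 <= B -> cmod (v 0 0) <= B ->
  cmod (v 1 0) <= B -> max_norm v <= B.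
Proof.
move=> B0 h0 h1; apply: max_norm_le => // i j; rewrite (ord1 j).
by move: i; apply: ord2P.
Qed.

(** The bracket starts at [k.+1] so that the convergent of index [k] is available to complete a
    matrix. *)
Lemma convergent_bracket (xi : R[i]) C p q X : convergent_seq d xi C p q ->
  cmod (q 1%N) <= X -> exists k, cmod (q k.+1) <= X < cmod (q k.+2).
Proof.
move=> cpq qX.
have ex : exists n, X < cmod (q n.+1).
  exists (Num.truncn (X ^+ 2)).+1; have [_ [_ _ h]] := cpq (Num.truncn (X ^+ 2)).+2.
  have X0 : 0 <= X by rewrite (le_trans (cmod_ge0 _) qX).
  rewrite -(@ltr_pXn2r _ 2) ?nnegrE ?cmod_ge0 //; apply: lt_le_trans h.
  by apply: lt_trans (truncnS_gt (X ^+ 2)) _; rewrite ltr_nat.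
case: (ex_minnP ex) => -[|n] Xn minn; first by rewrite ltNge qX in Xn.
exists n; rewrite Xn andbT leNgt; apply/negP => /minn.
by rewrite ltnn.
Qed.

Lemma convergent_bound (xi : R[i]) C p q n : 0 < C -> convergent_seq d xi C p q ->
  cmod (p n) <= (1 + cmod xi + C) * cmod (q n) /\
  cmod (q n) <= (1 + cmod xi + C) * cmod (q n).
Proof.
move=> C0 cpq; have [[_ _ q1 qS] [_ h _]] := cpq n.
have x0 := cmod_ge0 xi.
split; last by rewrite ler_peMl ?cmod_ge0 // -addrA lerDl addr_ge0 // ltW.
rewrite -[p n](subKr (q n * xi)) (le_trans (cmodD _ _)) // cmodN cmodM.
have hC : cmod (q n * xi - p n) <= C.
  by rewrite (le_trans h) // ler_piMr ?(ltW C0) // invf_le1 ?(le_trans q1) ?(ltW qS) //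
    (lt_le_trans _ (le_trans q1 (ltW qS))).
have : C <= C * cmod (q n) by rewrite ler_peMr // ltW.
have := cmod_ge0 (q n); lra.
Qed.

Section Fixed.
Variables (z : 'cV[R[i]]_2) (C : R) (p q : nat -> R[i]).
Hypotheses (gz : generic_slope d z) (C0 : 0 < C).
Hypothesis cpq : convergent_seq d (slope z) C p q.
Let L := 1 + cmod (slope z) + C.
Let Z := cmod (z 1 0).

Lemma convergent_row n :
  q n * z 0 0 + - p n * z 1 0 = z 1 0 * (q n * slope z - p n).
Proof. exact: (row_dotE gz). Qed.

Lemma convergent_row_bound n X : 0 < X -> X <= cmod (q n.+1) ->
  cmod (q n * z 0 0 + - p n * z 1 0) <= Z * C / X.
Proof.
move=> X0 hX; have [_ [_ h _]] := cpq n.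
rewrite convergent_row cmodM -mulrA ler_wpM2l ?cmod_ge0 //.
by rewrite (le_trans h) // ler_pM2l // lef_pV2 ?posrE // (lt_le_trans X0).
Qed.

Lemma convergent_row_lower eps : 0 < eps -> exists2 c, 0 < c &
  forall n, c * (L * cmod (q n)) `^ (- (1 + eps)) <=
    cmod (q n * z 0 0 + - p n * z 1 0).
Proof.
move=> eps0; have [c c0 hc] := generic_lower gz eps0; exists c => // n.
have [[rp rq q1 _] _] := cpq n; have [hp hq] := convergent_bound n C0 cpq.
apply: hc => //.
- exact: ringOKN.
- by rewrite xpair_eqE negb_and -cmod_gt0 (lt_le_trans ltr01 q1).
- by rewrite cmodN.
- by rewrite (le_trans q1).
Qed.

Let L1 : 1 <= L.
Proof. by rewrite /L -addrA lerDl addr_ge0 ?cmod_ge0 // ltW. Qed.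
Let L0 : 0 < L. Proof. exact: lt_le_trans ltr01 L1. Qed.
Let Z0 : 0 < Z.
Proof. by rewrite cmod_gt0 (generic_coord_neq0 gz). Qed.

(** Let |q_(k+1)| <= X < |q_(k+2)|, and let b and a be the values at z of the rows of index k and k
    + 1. Then |a| = O(1 / X), and the n nearest to (t - b) / a brings the first coordinate within
    |a| of t. For the norm, |n| <= 1 + (|t| + |b|) / |a| with 1 / |a| = O(X^(1+eps)) as z is
    generic. Multiplying by |q_(k+1)| <= X yields |t| X^(2+eps), while |b| = O(1 / |q_(k+1)|)
    cancels this factor and leaves X^(1+eps). *)
Lemma SL2OK_approx eps : 0 < eps -> exists D X0, [/\ 0 < D, 1 <= X0 &
  forall X t, X0 <= X -> exists2 g : 'M[R[i]]_2, SL2OK d g &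
    max_norm g <= D * (cmod t * X `^ (2 + eps) + X `^ (1 + eps)) /\
    max_norm (g *m z - col2 t 0) <= D / X].
Proof.
move=> eps0; have [c c0 hc] := convergent_row_lower eps0.
have e0 : 0 <= 1 + eps by rewrite addr_ge0 // ltW.
pose L' := L `^ (1 + eps); have L'0 : 0 < L' by rewrite powR_gt0.
have ZC0 : 0 < Z * C by rewrite mulr_gt0.
(* With Q = |q_(k+1)| and P = X^(1+eps), [A1], [A2] and [A3] are the coefficients of Q, |t| Q P and
   P once the bound for 1 + |n| is multiplied by L Q; [A4] is the constant of the error. *)
have [A1 A1E] : {A | A = 2 * L} by exists (2 * L).
have [A2 A2E] : {A | A = L * L' / c} by exists (L * L' / c).
have [A3 A3E] : {A | A = L * (Z * C) * L' / c} by exists (L * (Z * C) * L' / c).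
have [A4 A4E] : {A | A = Z * C} by exists (Z * C).
have A10 : 0 < A1 by rewrite A1E mulr_gt0.
have A20 : 0 < A2 by rewrite A2E divr_gt0 // mulr_gt0.
have A30 : 0 < A3 by rewrite A3E divr_gt0 // !mulr_gt0.
have A40 : 0 < A4 by rewrite A4E.
have [D DE] : {D | D = A1 + A2 + A3 + A4} by exists (A1 + A2 + A3 + A4).
have D0 : 0 < D by lra.
have [[_ _ q11 _] _] := cpq 1%N.
exists D, (cmod (q 1%N)); split=> // X t qX.
have X1 : 1 <= X by rewrite (le_trans q11).
have X0 : 0 < X by rewrite (lt_le_trans _ X1).
have [k /andP[kX Xk]] := convergent_bracket cpq qX.
have [[rpk rqk qk1 qkS] [dk _ _]] := cpq k.
have [[rpk' rqk' qk1' _] _] := cpq k.+1.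
have hv := convergent_row_bound X0 (ltW Xk).
have hlow := hc k.+1.
set a := (q k.+1 * z 0 0 + _) in hv hlow.
pose b := q k * z 0 0 + - p k * z 1 0.
pose Q := cmod (q k.+1); have Q0 : 0 < Q := lt_le_trans ltr01 qk1'.
have hb : cmod b <= Z * C / Q := convergent_row_bound Q0 (lexx _).
have P0 : 0 < (L * Q) `^ (- (1 + eps)) by rewrite powR_gt0 // mulr_gt0.
have a0 : 0 < cmod a by apply: lt_le_trans hlow; rewrite mulr_gt0.
have [n [rn hn]] := ringOK_euclid ((t - b) / a) hd.
have ZCX : Z * C / X <= D / X.
  by rewrite -A4E ler_pM2r ?invr_gt0 //; lra.
exists (mat2 (q k + n * q k.+1) (- p k + n * - p k.+1) (q k.+1) (- p k.+1)).
  apply: SL2OK_mat2 => //.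
  - by apply: ringOKD => //; exact: ringOKM.
  - by apply: ringOKD; [exact: ringOKN | apply: ringOKM => //; exact: ringOKN].
  - exact: ringOKN.
  - by rewrite -dk; ring.
split; last first.
  apply: max_norm_col; first by rewrite divr_ge0 // ltW.
    rewrite mxE mulmx2E !mat2E mxE col2E.
    have -> : (q k + n * q k.+1) * z 0 0 + (- p k + n * - p k.+1) * z 1 0 - t
       = - (((t - b) / a - n) * a).
      rewrite mulrBl divfK -?cmod_gt0 // /a /b; ring.
    rewrite cmodN cmodM (le_trans _ (le_trans hv ZCX)) // ler_piMl ?cmod_ge0 //.
    exact: ltW.
  by rewrite mxE mulmx2E !mat2E mxE col2E subr0 (le_trans hv).
pose P := X `^ (1 + eps).
have XP : X <= P by rewrite le1r_powR // lerDl ltW.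
have PE : X `^ (2 + eps) = X * P.
  by rewrite -[2]/(1 + 1) -addrA powR_gt0D // powRr1 // ltW.
have hLQ : (L * Q) `^ (1 + eps) <= L' * P.
  rewrite -powRM ?(ltW L0) ?(ltW X0) // le_powR2r // ?mulr_ge0 ?(ltW L0) ?(ltW Q0) //.
  by rewrite ler_pM2l.
have inva : (cmod a)^-1 <= L' * P / c.
  have LQ0 : 0 < (L * Q) `^ (1 + eps) by rewrite powR_gt0 // mulr_gt0.
  apply: le_trans (_ : _ <= (L * Q) `^ (1 + eps) / c) _.
    rewrite -[leRHS]invrK lef_pV2 ?posrE ?invr_gt0 ?divr_gt0 //.
    by rewrite invf_div -powRN.
  by rewrite ler_pM2r ?invr_gt0.
have hn' : cmod n <= 1 + (cmod t + Z * C / Q) * (L' * P / c).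
  rewrite -[n](subKr ((t - b) / a)) (le_trans (cmodD _ _)) // cmodN addrC lerD //.
    exact: ltW.
  rewrite cmodM cmodV ler_pM ?cmod_ge0 ?invr_ge0 ?cmod_ge0 //.
  by rewrite (le_trans (cmodD _ _)) // cmodN lerD2l.
have main : L * Q * (1 + cmod n) <= D * (cmod t * X `^ (2 + eps) + P).
  rewrite PE; apply: le_trans (_ : L * Q * (2 + (cmod t + Z * C / Q) * (L' * P / c)) <= _).
    by rewrite ler_pM2l ?mulr_gt0 // -[2]/(1 + 1) -addrA lerD2l.
  have -> : L * Q * (2 + (cmod t + Z * C / Q) * (L' * P / c)) =
      A1 * Q + A2 * (cmod t * (Q * P)) + A3 * P.
    by rewrite A1E A2E A3E; field; rewrite !gt_eqF.
  have QP : Q * P <= X * P by rewrite ler_pM2r // powR_gt0.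
  have P00 : 0 <= P by rewrite powR_ge0.
  have tt : 0 <= cmod t * (X * P) by rewrite mulr_ge0 ?cmod_ge0 // mulr_ge0 // ltW.
  have s1 : A1 * Q <= A1 * P by rewrite ler_pM2l // (le_trans _ XP).
  have s2 : A2 * (cmod t * (Q * P)) <= A2 * (cmod t * (X * P)).
    by rewrite ler_pM2l // ler_wpM2l // cmod_ge0.
  have s3 : A2 * (cmod t * (X * P)) <= D * (cmod t * (X * P)).
    by rewrite ler_wpM2r //; lra.
  have s4 : (A1 + A3) * P <= D * P.
    by rewrite ler_wpM2r //; lra.
  by rewrite mulrDr (le_trans _ (lerD s3 s4)) // mulrDl; lra.
have [hp hq] := convergent_bound k C0 cpq.
have [hp' hq'] := convergent_bound k.+1 C0 cpq.
have LQ0 : 0 <= L * Q by rewrite mulr_ge0 // ltW.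
have mono : L * cmod (q k) <= L * Q by rewrite ler_pM2l // ltW.
have row (x x' : R[i]) : cmod x <= L * cmod (q k) -> cmod x' <= L * Q ->
    cmod (x + n * x') <= D * (cmod t * X `^ (2 + eps) + P).
  move=> hx hx'; rewrite (le_trans _ main) // (le_trans (cmodD _ _)) //.
  rewrite cmodM mulrDr mulr1 lerD //; first exact: le_trans mono.
  by rewrite mulrC ler_wpM2r // cmod_ge0.
have row' (x' : R[i]) : cmod x' <= L * Q ->
    cmod x' <= D * (cmod t * X `^ (2 + eps) + P).
  move=> hx'; rewrite (le_trans hx') // (le_trans _ main) // ler_peMr //.
  by rewrite lerDl cmod_ge0.
apply: max_norm_mat2; rewrite -/P.
- by rewrite (le_trans _ main) // mulr_ge0 // addr_ge0 // cmod_ge0.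
- exact: row.
- by apply: row; rewrite cmodN.
- exact: row'.
- by apply: row'; rewrite cmodN.
Qed.

End Fixed.

End Approximation.

(** * Lower bounds 1, 1/2 and 1/3 for the uniform exponent *)

Section LowerBounds.
Variables (R : realType) (d : nat) (hd : d \in [:: 1; 3; 7; 11]%N).
Hypothesis hconv : has_convergents R d.
Implicit Types (t : R[i]) (z y : 'cV[R[i]]_2).

Lemma mulmx_col2 (g : 'M[R[i]]_2) t :
  g *m col2 t 0 = col2 (g 0 0 * t) (g 1 0 * t).
Proof.
apply/matrixP => i j; rewrite (ord1 j); move: i.
by apply: ord2P; rewrite mulmx2E !col2E mulr0 addr0.
Qed.

(** The matrix has columns (p_(k+1), q_(k+1)) and -(p_k, q_k), for convergents of the slope of y.
    With t = y_2 / q_(k+1) the second coordinate is hit exactly and the first is missed by |t|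
    |q_(k+1) slope - p_(k+1)| = O(|t| / Y). *)
Lemma slope_approx y eps : generic_slope d y -> 0 < eps ->
  exists D Y0, [/\ 0 < D, 1 <= Y0 & forall Y, Y0 <= Y ->
    exists g t, [/\ SL2OK d g, max_norm g <= D * Y,
      cmod t <= D * Y `^ (- (1 + eps)^-1) &
      max_norm (g *m col2 t 0 - y) <= D * (Y `^ (- (1 + eps)^-1) / Y)]].
Proof.
move=> gy eps0; have [y1 Ky _] := gy.
have [C [p [q [C0 cpq]]]] := hconv Ky.
have [c c0 hc] := convergent_row_lower gy C0 cpq eps0.
have e0 : 0 < 1 + eps by rewrite addr_gt0.
have [L LE] : {L | L = 1 + cmod (slope y) + C} by exists (1 + cmod (slope y) + C).
rewrite -LE in hc.
have [Z ZE] : {Z | Z = cmod (y 1 0)} by exists (cmod (y 1 0)).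
have Z0 : 0 < Z by rewrite ZE cmod_gt0.
have L0 : 0 < L by rewrite LE -addrA ltr_wpDr // addr_ge0 ?cmod_ge0 // ltW.
have ZC0 : 0 < Z * C by rewrite mulr_gt0.
pose s := (1 + eps)^-1.
have s0 : 0 < s by rewrite invr_gt0.
pose G := (Z * C / c) `^ s.
have G0 : 0 < G by rewrite powR_gt0 // divr_gt0.
pose D := L + Z * (L * G) + Z * C * (L * G).
have u1 : 0 < Z * (L * G) by rewrite !mulr_gt0.
have u2 : 0 < Z * C * (L * G) by rewrite !mulr_gt0.
have D1 : L <= D by rewrite /D -addrA lerDl addr_ge0 // ltW.
have D2 : Z * (L * G) <= D by rewrite /D addrAC lerDr addr_ge0 // ltW.
have D3 : Z * C * (L * G) <= D by rewrite /D lerDr addr_ge0 // ltW.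
have [[_ _ q11 _] _] := cpq 1%N.
exists D, (cmod (q 1%N)); split=> //; first exact: lt_le_trans D1.
move=> Y qY; have Y1 : 1 <= Y by rewrite (le_trans q11).
have Y0 : 0 < Y by rewrite (lt_le_trans _ Y1).
have [k /andP[kY Yk]] := convergent_bracket cpq qY.
have [[rpk rqk qk1 qkS] [dk _ _]] := cpq k.
have [[rpk' rqk' qk1' _] [_ hk _]] := cpq k.+1.
have Q0 : 0 < cmod (q k.+1) := lt_le_trans ltr01 qk1'.
(* The bracket only gives |q_(k+1)| <= Y, while a small t needs |q_(k+1)| large. Since |q_(k+2)| >
   Y, the form at row k + 1 is O(1 / Y); its generic lower bound then forces |q_(k+1)|^(1+eps) to be
   at least a constant times Y. *)
have Qinv : (cmod (q k.+1))^-1 <= L * G * Y `^ (- s).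
  have LQ0 : 0 < L * cmod (q k.+1) by rewrite mulr_gt0.
  have : Y * c / (Z * C) <= (L * cmod (q k.+1)) `^ (1 + eps).
    have := le_trans (hc k.+1) (convergent_row_bound gy C0 cpq Y0 (ltW Yk)).
    rewrite -ZE powRN ler_pdivrMr ?powR_gt0 // mulrAC ler_pdivlMr // => h.
    rewrite ler_pdivrMr // mulrC; rewrite [leRHS]mulrC //.
  have YZ0 : 0 < Y * c / (Z * C) by rewrite divr_gt0 // mulr_gt0.
  move=> /(le_powR2r (ltW s0) (ltW YZ0)).
  rewrite -[in leRHS]powRrM mulfV ?gt_eqF // powRr1 ?(ltW LQ0) // => h.
  have -> : L * G * Y `^ (- s) = L / (Y * c / (Z * C)) `^ s.
    rewrite /G powRN -mulrA; congr (_ * _).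
    have -> : Y * c / (Z * C) = Y * (Z * C / c)^-1 by rewrite invf_div mulrA.
    rewrite [(Y * _) `^ _]powRM ?invr_ge0 ?divr_ge0 ?(ltW Y0) ?(ltW ZC0) ?(ltW c0) //.
    rewrite powRV ?divr_ge0 ?(ltW ZC0) ?(ltW c0) //.
    by rewrite invfM invrK mulrC.
  by rewrite ler_pdivlMr ?powR_gt0 // mulrC ler_pdivrMr.
pose t := y 1 0 / q k.+1.
have ct : cmod t <= Z * (L * G * Y `^ (- s)).
  by rewrite cmodM cmodV -ZE ler_pM2l.
exists (mat2 (p k.+1) (- p k) (q k.+1) (- q k)), t; split.
- apply: SL2OK_mat2 => //; [exact: ringOKN | exact: ringOKN |].
  by rewrite -dk; ring.
- have [hp hq] := convergent_bound k C0 cpq.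
  have [hp' hq'] := convergent_bound k.+1 C0 cpq.
  rewrite -LE in hp hq hp' hq'.
  have hB : L * cmod (q k.+1) <= D * Y.
    by rewrite ler_pM ?cmod_ge0 // ltW.
  have hB' : L * cmod (q k) <= D * Y by rewrite (le_trans _ hB) // ler_pM2l // ltW.
  apply: max_norm_mat2; rewrite ?cmodN.
  + by rewrite (le_trans _ hB) // mulr_ge0 ?cmod_ge0 // ltW.
  + exact: le_trans hB.
  + exact: le_trans hB'.
  + exact: le_trans hB.
  + exact: le_trans hB'.
- by rewrite (le_trans ct) // mulrA ler_wpM2r ?powR_ge0.
- rewrite mulmx_col2 !mat2E; apply: max_norm_col.
  + by rewrite mulr_ge0 ?divr_ge0 ?powR_ge0 ?(ltW Y0) // (le_trans _ D1) // ltW.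
  + rewrite mxE col2E mxE.
    have qn0 : q k.+1 != 0 by rewrite -cmod_gt0.
    have -> : p k.+1 * t - y 0 0 = - (t * (q k.+1 * slope y - p k.+1)).
      by rewrite /t /slope; field; rewrite y1 qn0.
    rewrite cmodN cmodM.
    have hC : cmod (q k.+1 * slope y - p k.+1) <= C / Y.
      by rewrite (le_trans hk) // ler_pM2l // lef_pV2 ?posrE ?ltW // (lt_trans Y0).
    rewrite (le_trans (ler_pM (cmod_ge0 _) (cmod_ge0 _) ct hC)) //.
    have -> : Z * (L * G * Y `^ (- s)) * (C / Y) =
       Z * C * (L * G) * (Y `^ (- s) / Y) by ring.
    by rewrite ler_wpM2r // divr_ge0 ?powR_ge0 // ltW.
  + rewrite mxE col2E mxE /t.
    have qn0 : q k.+1 != 0 by rewrite -cmod_gt0.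
    rewrite mulrC divfK // subrr cmod0.
    by rewrite mulr_ge0 ?divr_ge0 ?powR_ge0 ?(ltW Y0) // (le_trans _ D1) // ltW.
Qed.

(** For t = 0 the term X^(2+eps) disappears, leaving norm X^(1+eps) against error 1 / X. *)
Lemma hat_approximable_zero z w : generic_slope d z -> 0 < w < 1 ->
  hat_approximable d z 0 w.
Proof.
move=> gz /andP[w0 w1]; have [_ Kz _] := gz.
have [C [p [q [C0 cpq]]]] := hconv Kz.
pose eps := (1 - w) / 2; have eps0 : 0 < eps by rewrite divr_gt0 // subr_gt0.
have [D [X0 [D0 X01 H]]] := SL2OK_approx hd gz C0 cpq eps0.
apply: (@hat_approximableP _ _ _ _ (1 + eps) 1 D X0) => //.
- by rewrite addr_gt0.
- by rewrite /eps; nra.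
- move=> X hX; have [g hg [h1 h2]] := H X 0 hX; exists g => //.
  have X0' : 0 < X by rewrite (lt_le_trans _ (le_trans X01 hX)).
  split; first by move: h1; rewrite cmod0 mul0r add0r.
  rewrite powR_inv1 ?(ltW X0') //.
  suff <- : col2 0 0 = 0 :> 'cV[R[i]]_2 by [].
  by apply/matrixP => i j; rewrite !mxE; case: ifP.
Qed.

(** This reduces a target of slope in K to (tau, 0), up to a fixed matrix that alters norms and
    errors only by constant factors. *)
Lemma quadK_column y : y 1 0 != 0 -> quadK d (slope y) ->
  exists M tau, [/\ SL2OK d M, y = M *m col2 tau 0 & tau != 0].
Proof.
move=> y1 Ky; have [x [x' [rx rx' x'0 xE]]] := quadK_fracP Ky.
have [M [t [hM xM x'M]]] := SL2OK_column hd rx rx'.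
exists M, (y 1 0 / x' * t); split=> //; last first.
  rewrite !mulf_neq0 ?invr_eq0 //; apply: contra x'0 => /eqP t0.
  by rewrite x'M t0 mulr0.
apply/matrixP => i j; rewrite (ord1 j) mulmx_col2; move: i; apply: ord2P; rewrite col2E.
  have -> : y 0 0 = y 1 0 * slope y by rewrite /slope mulrC divfK.
  by rewrite xE xM; ring.
transitivity (y 1 0 / x' * (M 1 0 * t)); first by rewrite -x'M divfK.
by ring.
Qed.

Lemma hat_approximable_quadK z y w : generic_slope d z -> y 1 0 != 0 ->
  quadK d (slope y) -> 0 < w < 2^-1 -> hat_approximable d z y w.
Proof.
move=> gz y1 Ky /andP[w0 w1]; have [_ Kz _] := gz.
have [C [p [q [C0 cpq]]]] := hconv Kz.
have [M [tau [hM yE _]]] := quadK_column y1 Ky.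
pose eps := (1 - 2 * w) / 2; have eps0 : 0 < eps by rewrite divr_gt0 // subr_gt0; lra.
have [D [X0 [D0 X01 H]]] := SL2OK_approx hd gz C0 cpq eps0.
have [N NE] : {N | N = max_norm M} by exists (max_norm M).
have N1 : 1 <= N by rewrite NE; exact: SL2OK_norm_ge1 hM.
have c0 : 0 <= cmod tau by exact: cmod_ge0.
have N0 : 0 < N by rewrite (lt_le_trans _ N1).
have c1 : 1 <= cmod tau + 1 by rewrite lerDr.
apply: (@hat_approximableP _ _ _ _ (2 + eps) 1 (2 * N * D * (cmod tau + 1)) X0) => //.
- by rewrite addr_gt0.
- by rewrite !mulr_gt0 // (lt_le_trans _ c1).
- by rewrite /eps; nra.
- move=> X hX; have [g hg [h1 h2]] := H X tau hX; exists (M *m g); first exact: SL2OK_mul.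
  have X1 : 1 <= X := le_trans X01 hX.
  have X0' : 0 < X by rewrite (lt_le_trans _ X1).
  split.
    rewrite (le_trans (max_norm_mul _ _)) // -NE -!mulrA !ler_pM2l //.
    rewrite (le_trans h1) // ler_pM2l // [leRHS]mulrDl mul1r lerD2l ler_powR //.
    by rewrite lerD2r ler1n.
  rewrite yE -mulmxA -mulmxBr (le_trans (max_norm_mul _ _)) // -NE.
  rewrite powR_inv1 ?(ltW X0') // -!mulrA !ler_pM2l // (le_trans h2) //.
  by rewrite ler_pM2l // ler_peMl // invr_ge0 ltW.
Qed.

(* The optimum balances the two errors at Y = X^(1/3). *)
Lemma hat_approximable_generic z y w : generic_slope d z -> generic_slope d y ->
  0 < w < 3^-1 -> hat_approximable d z y w.
Proof.
move=> gz gy /andP[w0 w1]; have [_ Kz _] := gz.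
have [C [p [q [C0 cpq]]]] := hconv Kz.
(* So w = 1/3 - 3 eps, which leaves room for w (2 + 2 eps) < 2/3 - eps. *)
pose eps := (1 - 3 * w) / 9.
have eps0 : 0 < eps by rewrite /eps; lra.
have eps1 : eps < 1 by rewrite /eps; lra.
have [D [X0 [D0 X01 H]]] := SL2OK_approx hd gz C0 cpq eps0.
have [E [Y0 [E0 Y01 H']]] := slope_approx gy eps0.
pose s := (1 + eps)^-1.
have e0 : 0 < 1 + eps by rewrite addr_gt0.
have s1 : 1 - eps <= s.
  by rewrite /s -(ler_pM2r e0) mulVf ?gt_eqF //; nra.
have s0 : 0 < s by rewrite invr_gt0.
pose K := 2 * E * D * (E + 1) + 2 * E * D + E.
have K0 : 0 < K by rewrite /K !addr_gt0 // !mulr_gt0 // addr_gt0.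
(* The threshold [Y0 ^ 3] ensures Y = X^(1/3) >= Y0. *)
apply: (@hat_approximableP _ _ _ _ (2 + 2 * eps) (2 / 3 - eps) K
         (Num.max X0 (Y0 `^ 3))) => //.
- by lra.
- by rewrite /eps; nra.
move=> X; rewrite ge_max => /andP[hX hX'].
have X1 : 1 <= X := le_trans X01 hX.
have X0' : 0 < X by rewrite (lt_le_trans _ X1).
pose Y := X `^ 3^-1.
have Y00 : 0 < Y by rewrite powR_gt0.
have hY : Y0 <= Y.
  have Y0pos : 0 <= Y0 by rewrite (le_trans _ Y01).
  rewrite -[Y0]powRr1 // -[1](@mulfV _ 3) // powRrM /Y.
  by rewrite le_powR2r // powR_ge0.
have [M [t [hM MY ct hMy]]] := H' Y hY.
have [g hg [h1 h2]] := H X t hX.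
exists (M *m g); first exact: SL2OK_mul.
have YP r : Y `^ r = X `^ (r / 3) by rewrite /Y -powRrM mulrC.
have Xmono r r' : r <= r' -> X `^ r <= X `^ r' by move=> h; rewrite ler_powR.
split.
- rewrite (le_trans (max_norm_mul _ _)) //.
  have b1 : max_norm g <= D * (E * X `^ (2 + eps - s / 3) + X `^ (1 + eps)).
    rewrite (le_trans h1) // ler_pM2l // lerD2r.
    rewrite (le_trans (ler_wpM2r (powR_ge0 _ _) ct)) // -mulrA YP -powR_gt0D //.
    by rewrite ler_pM2l // Xmono // -/s mulNr addrC.
  rewrite (le_trans (ler_pM _ (max_norm_ge0 _) (ler_wpM2l _ MY) b1)) //.
    by rewrite mulr_ge0 ?max_norm_ge0.
  have -> : 2 * (E * Y) * (D * (E * X `^ (2 + eps - s / 3) + X `^ (1 + eps))) =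
     2 * E * D * (E * (Y * X `^ (2 + eps - s / 3)) + Y * X `^ (1 + eps)) by ring.
  rewrite /Y -!powR_gt0D //.
  have m1 : X `^ (3^-1 + (2 + eps - s / 3)) <= X `^ (2 + 2 * eps).
    by apply: Xmono; lra.
  have m2 : X `^ (3^-1 + (1 + eps)) <= X `^ (2 + 2 * eps).
    by apply: Xmono; lra.
  apply: (@le_trans _ _ (2 * E * D * (E + 1) * X `^ (2 + 2 * eps))).
    rewrite -[leRHS]mulrA ler_pM2l ?mulr_gt0 // [leRHS]mulrDl mul1r lerD //.
    by rewrite ler_pM2l.
  rewrite ler_wpM2r ?powR_ge0 // /K -addrA lerDl addr_ge0 ?(ltW E0) //.
  by rewrite !mulr_ge0 // ltW.
(* The error at (t, 0) is magnified by |M| = O(Y); the second error comes from the convergent of the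
   slope of y. *)
- have -> : M *m g *m z - y = M *m (g *m z - col2 t 0) + (M *m col2 t 0 - y).
    by rewrite mulmxBr mulmxA addrA subrK.
  rewrite (le_trans (max_normD _ _)) // (le_trans (lerD (max_norm_mul _ _) hMy)) //.
  have b1 : 2 * max_norm M * max_norm (g *m z - col2 t 0) <= 2 * E * D * (Y / X).
    rewrite (le_trans (ler_pM _ (max_norm_ge0 _) (ler_wpM2l _ MY) h2)) //.
      by rewrite mulr_ge0 ?max_norm_ge0.
    by rewrite le_eqVlt; apply/orP; left; apply/eqP; ring.
  have m1 : Y / X <= X `^ (- (2 / 3 - eps)).
    rewrite -[X^-1]powR_inv1 ?(ltW X0') // /Y -powR_gt0D //.
    by apply: Xmono; lra.
  have m2 : Y `^ (- s) / Y <= X `^ (- (2 / 3 - eps)).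
    rewrite -[Y^-1]powR_inv1 ?(ltW Y00) // -powR_gt0D // YP.
    by apply: Xmono; lra.
  apply: (@le_trans _ _ ((2 * E * D + E) * X `^ (- (2 / 3 - eps)))).
    rewrite [leRHS]mulrDl lerD // ?ler_pM2l //.
    by rewrite (le_trans b1) // ler_pM2l // !mulr_gt0.
  rewrite ler_wpM2r ?powR_ge0 // /K -addrA lerDr.
  by rewrite !mulr_ge0 // ?addr_ge0 // ltW.
Qed.

End LowerBounds.

(** * Comparison of the two exponents; the target 0; targets off the orbit *)

Section UpperBounds.
Variables (R : realType) (d : nat) (hd : d \in [:: 1; 3; 7; 11]%N).
Implicit Types (z y : 'cV[R[i]]_2) (g : 'M[R[i]]_2).

Lemma discriminant_gt0 : (0 < d)%N.
Proof. by move: hd; rewrite !inE => /or4P[] /eqP ->. Qed.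

Definition mu_solutions z y (w : R) : set 'M[R[i]]_2 :=
  [set g | SL2OK d g /\ max_norm (g *m z - y) <= max_norm g `^ (- w)].

Lemma mu_solutions_sub z y w w' : w <= w' ->
  mu_solutions z y w' `<=` mu_solutions z y w.
Proof.
move=> ww g [hg h]; split=> //; rewrite (le_trans h) // ler_powR ?lerN2 //.
exact: SL2OK_norm_ge1 hg.
Qed.

Lemma muG_le z y (L : R) :
  (forall w, L < w -> finite_set (mu_solutions z y w)) -> (muG d z y <= L%:E)%E.
Proof.
move=> H; apply: ge_ereal_sup => _ [w wS <-]; rewrite lee_fin leNgt.
by apply/negP => /H.
Qed.

Lemma hat_muG_ge z y (L : R) : 0 < L ->
  (forall w, 0 < w < L -> hat_approximable d z y w) -> (L%:E <= hat_muG d z y)%E.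
Proof.
move=> L0 H; apply/lee_addgt0Pr => e e0.
pose w := Num.max (L - e) (L / 2).
have hw : 0 < w < L.
  by rewrite /w lt_max gt_max ltrBlDr ltrDl e0 divr_gt0 // orbT /=; lra.
have : (w%:E <= hat_muG d z y)%E by apply: ereal_sup_ubound; exists w => //; exact: H.
move=> hle; apply: (@le_trans _ _ (w%:E + e%:E)%E); last by rewrite leeD2r.
by rewrite -EFinD lee_fin -lerBlDr /w le_max lexx.
Qed.

(** If the solutions were finite in number, their errors would have a positive minimum c, as y is
    off the orbit. For T with T^(-w) <= c / 2 the uniform property yields a g whose error is below
    c, yet g is a solution because |g| <= T. *)
Lemma hat_approximable_mu z y w : 0 < w ->
  (forall g, SL2OK d g -> g *m z != y) -> hat_approximable d z y w ->
  infinite_set (mu_solutions z y w).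
Proof.
move=> w0 hit hw fin.
have [|c c0 hc] := finite_set_pos_min (f := fun g => max_norm (g *m z - y)) fin.
  move=> g [hg _]; rewrite lt_neqAle max_norm_ge0 andbT eq_sym.
  apply: contra (hit _ hg) => /eqP h; rewrite -subr_eq0; apply/eqP/matrixP => i j.
  apply/eqP; rewrite [eqbRHS]mxE -cmod_eq0 eq_le cmod_ge0 andbT -h.
  exact: max_norm_ge.
have hnear : \forall T \near +oo, 2 / c <= T `^ w by exact: near_powR_ge.
have [T [T0 [g [hg h1 h2]] hT]] : exists T, [/\ 0 < T, exists g : 'M[R[i]]_2,
    [/\ SL2OK d g, max_norm (g *m z - y) <= T `^ (- w) & max_norm g <= T] &
    2 / c <= T `^ w].
  have hpos : \forall T \near +oo, (0 : R) < T by exact: nbhs_pinfty_gt.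
  by have [T [? [? ?]]] := filter_ex (filterI hpos (filterI hw hnear)); exists T.
have g1 := SL2OK_norm_ge1 hg.
have : mu_solutions z y w g.
  by split=> //; rewrite (le_trans h1) // le_powRN2r // ?ltW // (lt_le_trans ltr01).
move=> /hc/le_trans/(_ h1); rewrite powRN => hcT.
have : c * (2 / c) <= c * T `^ w by rewrite ler_pM2l.
rewrite mulrC divfK ?gt_eqF //.
rewrite -(ler_pM2r (powR_gt0 w T0)) mulVf ?gt_eqF ?powR_gt0 // in hcT.
lra.
Qed.

(** The preceding argument needs T^(-w) -> 0, hence w > 0. The one positive exponent [w0] takes care
    of all exponents below it. *)
Lemma hat_muG_le_muG z y w0 : 0 < w0 -> hat_approximable d z y w0 ->
  (forall g, SL2OK d g -> g *m z != y) -> (hat_muG d z y <= muG d z y)%E.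
Proof.
move=> w00 hw0 hit; apply: ge_ereal_sup => _ [w hw <-].
have [w0w|ww0] := ltP w0 w.
  apply: ereal_sup_ubound; exists w => //.
  by apply: hat_approximable_mu => //; exact: lt_trans w0w.
apply: (@le_trans _ _ w0%:E); first by rewrite lee_fin.
by apply: ereal_sup_ubound; exists w0 => //; exact: hat_approximable_mu.
Qed.

Lemma powR_le_bound (B r K : R) : 0 < B -> 0 < r -> B `^ r <= K -> B <= K `^ r^-1.
Proof.
move=> B0 r0 h; rewrite -[B](@powRVK _ _ r^-1) ?invr_eq0 ?gt_eqF // invrK.
by rewrite le_powR2r ?powR_ge0 // invr_ge0 ltW.
Qed.

Lemma SL2OK_row0_neq0 g : SL2OK d g -> (g 0 0, g 0 1) != (0, 0).
Proof.
move=> /SL2OK_det dg; apply/eqP => -[g00 g01]; move: dg.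
by rewrite g00 g01 !mul0r subrr => /eqP; rewrite eq_sym oner_eq0.
Qed.

Lemma SL2OK_row1_neq0 g : SL2OK d g -> (g 1 0, g 1 1) != (0, 0).
Proof.
move=> /SL2OK_det dg; apply/eqP => -[g00 g01]; move: dg.
by rewrite g00 g01 !mulr0 subrr => /eqP; rewrite eq_sym oner_eq0.
Qed.

(** Here w = 1 + 2 eps. The first row gives c |g|^(-1-eps) <= |g z| <= |g|^(-w), so |g|^eps <= 1 /
    c, and balls of SL_2(O_K) are finite. *)
Lemma mu_zero_finite z w : generic_slope d z -> 1 < w ->
  finite_set (mu_solutions z 0 w).
Proof.
move=> gz w1; pose eps := (w - 1) / 2.
have eps0 : 0 < eps by rewrite divr_gt0 // subr_gt0.
have [c c0 hc] := generic_lower gz eps0.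
apply: (sub_finite_set _ (finite_SL2OK_ball ((c^-1) `^ eps^-1) discriminant_gt0)).
move=> g [hg h]; split=> //; have [rg _] := hg.
have B1 := SL2OK_norm_ge1 hg; have B0 := lt_le_trans ltr01 B1.
apply: powR_le_bound => //.
have := hc _ _ (max_norm g) (rg 0 0) (rg 0 1) (SL2OK_row0_neq0 hg)
  (max_norm_ge _ _ _) (max_norm_ge _ _ _) B1.
rewrite -mulmx2E => h1; have := max_norm_ge (g *m z) 0 0.
rewrite subr0 in h; move=> h2; have := le_trans h1 (le_trans h2 h).
have -> : - w = - (1 + eps) + - eps by rewrite /eps; lra.
rewrite powR_gt0D // mulrC ler_pM2l ?powR_gt0 // powRN => h3.
by rewrite -[leLHS]invrK lef_pV2 ?posrE ?invr_gt0 ?powR_gt0.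
Qed.

Lemma mulmx_generic_neq0 z g : generic_slope d z -> SL2OK d g -> g *m z != 0.
Proof.
move=> gz hg; apply/eqP => /matrixP h; have /eqP := generic_coord_neq0 gz; apply.
have dg := SL2OK_det hg.
have := h 0 0; have := h 1 0; rewrite !mulmx2E !mxE => h1 h0.
rewrite -[z 1 0]mul1r -dg.
have -> : (g 0 0 * g 1 1 - g 0 1 * g 1 0) * z 1 0 =
   g 0 0 * (g 1 0 * z 0 0 + g 1 1 * z 1 0) - g 1 0 * (g 0 0 * z 0 0 + g 0 1 * z 1 0).
  by ring.
by rewrite h0 h1 !mulr0 subrr.
Qed.

Definition adj2 g := mat2 (g 1 1) (- g 0 1) (- g 1 0) (g 0 0).

Lemma SL2OK_adj2 g : SL2OK d g -> SL2OK d (adj2 g).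
Proof.
move=> hg; have [rg _] := hg; have dg := SL2OK_det hg.
by apply: SL2OK_mat2 => //; try exact: ringOKN; rewrite -dg; ring.
Qed.

Lemma adj2_mul g (v : 'cV[R[i]]_2) : SL2OK d g -> adj2 g *m (g *m v) = v.
Proof.
move=> hg; have dg := SL2OK_det hg; apply/matrixP => i j; rewrite (ord1 j).
have sub (x : R[i]) : (g 0 0 * g 1 1 - g 0 1 * g 1 0) * x = x by rewrite dg mul1r.
move: i; apply: ord2P; rewrite !mulmx2E !mat2E.
  by rewrite -[RHS]sub; ring.
by rewrite -[RHS]sub; ring.
Qed.

Lemma max_norm_adj2 g : max_norm (adj2 g) <= max_norm g.
Proof. by apply: max_norm_mat2; rewrite ?max_norm_ge0 ?cmodN ?max_norm_ge. Qed.

(** After applying the inverse of M, equality would make the second row of an element of SL_2(O_K)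
    vanish at z. *)
Lemma mulmx_quadK_neq z y g : generic_slope d z -> y 1 0 != 0 ->
  quadK d (slope y) -> SL2OK d g -> g *m z != y.
Proof.
move=> gz y1 Ky hg; have [M [tau [hM yE _]]] := quadK_column hd y1 Ky.
have hh := SL2OK_mul (SL2OK_adj2 hM) hg; have [rh _] := hh.
set h := _ *m _ in hh rh; apply/eqP => gzy.
have hz : h *m z = col2 tau 0 by rewrite /h -mulmxA gzy yE adj2_mul.
have [c c0 hc] := generic_lower gz (ltr01 : 0 < 1 :> R).
have B1 := SL2OK_norm_ge1 hh; have B0 := lt_le_trans ltr01 B1.
have := hc _ _ (max_norm h) (rh 1 0) (rh 1 1) (SL2OK_row1_neq0 hh)
  (max_norm_ge _ _ _) (max_norm_ge _ _ _) B1.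
rewrite -mulmx2E hz col2E cmod0 leNgt mulr_gt0 //.
by rewrite powR_gt0.
Qed.

End UpperBounds.

(** * Upper bound 1/2 for targets of slope in K *)

Section RationalTarget.
Variables (R : realType) (d : nat) (hd : d \in [:: 1; 3; 7; 11]%N).
Implicit Types (z y : 'cV[R[i]]_2) (g : 'M[R[i]]_2).

Lemma subr_col2E (v : 'cV[R[i]]_2) (a b : R[i]) :
  ((v - col2 a b) 0 0 = v 0 0 - a) * ((v - col2 a b) 1 0 = v 1 0 - b).
Proof. by rewrite !mxE. Qed.

(* In terms of the rows u, v of h, Cramer's rule gives (u z) v = (v z) u + (- z_2, z_1),
   so a small v z forces v to be much shorter than u. *)
Lemma SL2OK_second_row z g (tau : R[i]) (A B delta : R) :
  SL2OK d g -> tau != 0 -> max_norm g <= A * B -> max_norm (g *m z - col2 tau 0) <= delta ->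
  delta <= cmod tau / 2 -> max_norm z <= A * B * delta -> forall j,
  cmod (g 1 j) <= 4 * A / cmod tau * (B * delta).
Proof.
move=> hg tau0 gB hdelta dtau zB.
have dg := SL2OK_det hg.
pose u := (g *m z) 0 0; pose v := (g *m z) 1 0.
have hu : cmod (u - tau) <= delta.
  by have := le_trans (max_norm_ge (g *m z - col2 tau 0) 0 0) hdelta;
    rewrite subr_col2E.
have hv : cmod v <= delta.
  by have := le_trans (max_norm_ge (g *m z - col2 tau 0) 1 0) hdelta;
    rewrite subr_col2E subr0.
have t0 : 0 < cmod tau by rewrite cmod_gt0.
have delta0 : 0 <= delta := le_trans (cmod_ge0 _) hv.
(* The assumption on [delta] keeps u away from 0, so the identity of Cramer can be divided by it. *)
have utau : cmod tau / 2 <= cmod u.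
  have := cmodB_le tau (tau - u); rewrite subKr cmodB => h.
  by have := cmodB u tau; lra.
have core (x a c : R[i]) : x * u = a * v + c -> cmod a <= max_norm g ->
    cmod c <= max_norm z -> cmod x <= 4 * A / cmod tau * (B * delta).
  move=> E ha hc.
  have h1 : cmod x * cmod u <= 2 * (A * B * delta).
    rewrite -cmodM E (le_trans (cmodD _ _)) // cmodM mulr_natl mulr2n lerD //.
      by rewrite ler_pM ?cmod_ge0 // (le_trans ha).
    exact: le_trans hc zB.
  have h2 : cmod x * (cmod tau / 2) <= 2 * (A * B * delta).
    by rewrite (le_trans _ h1) // ler_wpM2l ?cmod_ge0.
  have -> : 4 * A / cmod tau * (B * delta) = 2 * (A * B * delta) / (cmod tau / 2).
    by field; rewrite gt_eqF.
  by rewrite ler_pdivlMr // divr_gt0.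
apply: ord2P.
  apply: (core _ (g 0 0) (- z 1 0)); rewrite ?cmodN ?max_norm_ge //.
  by rewrite /u /v !mulmx2E -[z 1 0]mul1r -{3}dg; ring.
apply: (core _ (g 0 1) (z 0 0)); rewrite ?max_norm_ge //.
by rewrite /u /v !mulmx2E -[X in _ = _ + X]mul1r -dg; ring.
Qed.

(** With B = |g|, the second row of [h] is O(B^(1-w)), so its form is at least a constant times
    B^(-(1-w)(1+eps)), and it is O(B^(-w)). For eps = 2 w - 1 one has (1 - w)(1 + eps) = w - w eps,
    so B^(w eps) is bounded; w > 1/2 is what makes eps positive. *)
Lemma mu_quadK_finite z y w : generic_slope d z -> y 1 0 != 0 ->
  quadK d (slope y) -> 2^-1 < w -> finite_set (mu_solutions d z y w).
Proof.
move=> gz y1 Ky w2.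
(* Solutions for w are solutions for any smaller exponent, so w may be lowered into (1/2, 1); there
   B^(1-w) >= 1 absorbs constants. *)
wlog w1 : w w2 / w < 1.
  move=> H; pose w' := Num.min w (3 / 4).
  apply: (sub_finite_set (mu_solutions_sub (w := w') _ )); first by rewrite ge_min lexx.
  by apply: H; rewrite /w' ?lt_min ?gt_min ?w2 /=; lra.
have w0 : 0 < w by lra.
have [M [tau [hM yE tau0]]] := quadK_column hd y1 Ky.
pose eps := 2 * w - 1; have eps0 : 0 < eps by rewrite /eps; lra.
have [c c0 hc] := generic_lower gz eps0.
have [N NE] : {N | N = max_norm M} by exists (max_norm M).
have N0 : 0 < N by rewrite NE (lt_le_trans ltr01) // (SL2OK_norm_ge1 hM).
have [m mE] : {m | m = max_norm z} by exists (max_norm z).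
have m0 : 0 <= m by rewrite mE max_norm_ge0.
have t0 : 0 < cmod tau by rewrite cmod_gt0.
(* The first term gives |h| <= A B; the second gives |z| <= A B delta, since B delta >= 2 N. *)
pose A := 2 * N + m / (2 * N).
have A0 : 0 < A by rewrite ltr_pwDl ?mulr_gt0 // divr_ge0 // mulr_ge0 // ltW.
pose E := 1 + 4 * A / cmod tau * (2 * N).
have E1 : 1 <= E by rewrite lerDl !mulr_ge0 ?invr_ge0 ?ltW.
have E0 : 0 < E := lt_le_trans ltr01 E1.
(* Beyond [K1] the error [delta] is at most |tau| / 2; [K2] is the bound for B from the comparison
   of exponents. *)
pose K1 := (4 * N / cmod tau) `^ w^-1.
pose K2 := (2 * N / (c * E `^ (- (1 + eps)))) `^ (w * eps)^-1.
apply: (sub_finite_set _ (finite_SL2OK_ball (Num.max K1 K2) (discriminant_gt0 hd))).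
move=> g [hg hgy]; split=> //.
have B1 := SL2OK_norm_ge1 hg; set B := max_norm g in B1 hgy *.
have B0 := lt_le_trans ltr01 B1.
rewrite le_max; have [//|BK1] := leP B K1; rewrite /=.
pose h := adj2 M *m g; have hh : SL2OK d h := SL2OK_mul (SL2OK_adj2 hM) hg.
pose delta := 2 * N * B `^ (- w).
have hB : max_norm h <= 2 * N * B.
  rewrite (le_trans (max_norm_mul _ _)) // -/B ler_pM2r // ler_pM2l // NE.
  exact: max_norm_adj2.
have hdelta : max_norm (h *m z - col2 tau 0) <= delta.
  have -> : h *m z - col2 tau 0 = adj2 M *m (g *m z - y).
    by rewrite mulmxBr yE (adj2_mul _ hM) mulmxA.
  rewrite (le_trans (max_norm_mul _ _)) // /delta ler_pM ?mulr_ge0 ?max_norm_ge0 //.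
  by rewrite ler_pM2l // NE max_norm_adj2.
have dtau : delta <= cmod tau / 2.
  have Bw : 4 * N / cmod tau <= B `^ w.
    rewrite leNgt; apply/negP => hlt; move: BK1; rewrite ltNge => /negP; apply.
    by apply: powR_le_bound => //; exact: ltW.
  rewrite /delta powRN ler_pdivrMr ?powR_gt0 //.
  have -> : 2 * N = cmod tau / 2 * (4 * N / cmod tau) by field; rewrite gt_eqF.
  by rewrite ler_pM2l // divr_gt0.
have Bd : B * delta = 2 * N * B `^ (1 - w).
  by rewrite /delta powR_gt0D // powRr1 ?(ltW B0) //; ring.
have B1w : 1 <= B `^ (1 - w) by apply: powR_ge1 => //; lra.
have hrow := SL2OK_second_row hh tau0 _ hdelta dtau _.
have row j : cmod (h 1 j) <= E * B `^ (1 - w).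
  have hA : max_norm h <= A * B.
    by rewrite (le_trans hB) // ler_pM2r // /A lerDl divr_ge0 // mulr_ge0 // ltW.
  have zA : max_norm z <= A * B * delta.
    rewrite -mulrA Bd -mE; apply: (@le_trans _ _ (A * (2 * N))).
      by rewrite /A mulrDl divfK ?gt_eqF ?mulr_gt0 // lerDr !mulr_ge0 // ltW.
    by rewrite ler_pM2l // ler_peMr // mulr_ge0 // ltW.
  rewrite (le_trans (hrow _ _ hA zA j)) // Bd mulrA ler_wpM2r ?powR_ge0 //.
  by rewrite /E lerDr.
have EB1 : 1 <= E * B `^ (1 - w) by rewrite -[leLHS]mulr1 ler_pM.
have [rh _] := hh.
have := hc _ _ _ (rh 1 0) (rh 1 1) (SL2OK_row1_neq0 hh) (row 0) (row 1) EB1.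
rewrite -mulmx2E => low.
have up : cmod ((h *m z) 1 0) <= delta.
  by have := le_trans (max_norm_ge (h *m z - col2 tau 0) 1 0) hdelta;
    rewrite subr_col2E subr0.
apply: powR_le_bound => //; first by rewrite mulr_gt0.
have cE0 : 0 < c * E `^ (- (1 + eps)) by rewrite mulr_gt0 // powR_gt0.
rewrite ler_pdivlMr // mulrC.
have := le_trans low up; rewrite powRM ?powR_ge0 ?(ltW E0) // -powRrM mulrA /delta.
have -> : B `^ (- w) = B `^ ((1 - w) * - (1 + eps)) * B `^ (- (w * eps)).
  by rewrite -powR_gt0D //; congr (_ `^ _); rewrite /eps; ring.
rewrite mulrCA [leLHS]mulrC ler_pM2l ?powR_gt0 // (powRN B).
by rewrite ler_pdivlMr ?powR_gt0.
Qed.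

End RationalTarget.

(** * Summability over index sets *)

Section SummableOn.
Variable R : realType.

(** For nonnegative f, uniformly bounded finite sums amount to summability, without choosing an
    enumeration of S. *)
Definition summable_on (I : eqType) (S : set I) (f : I -> R) : Prop :=
  exists M, forall s : seq I, uniq s -> (forall i, i \in s -> S i) ->
    \sum_(i <- s) f i <= M.

Lemma ler_sum_subset (I : eqType) (s t : seq I) (f : I -> R) :
  (forall i, 0 <= f i) -> uniq s -> uniq t -> {subset s <= t} ->
  \sum_(i <- s) f i <= \sum_(i <- t) f i.
Proof.
move=> f0 us ut st.
have p : perm_eq s [seq i <- t | i \in s].
  apply: uniq_perm => //; first exact: filter_uniq.
  by move=> i; rewrite mem_filter; have [/st ->|//] := boolP (i \in s).
rewrite (perm_big _ p) big_filter big_mkcond /=.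
by apply: ler_sum => i _; case: ifP.
Qed.

Lemma summable_on_inj (I J : eqType) (S : set I) (S' : set J) (phi : I -> J)
    (C : R) f g : 0 <= C -> (forall i, S i -> S' (phi i)) ->
  (forall i i', S i -> S i' -> phi i = phi i' -> i = i') ->
  (forall i, S i -> f i <= C * g (phi i)) ->
  summable_on S' g -> summable_on S f.
Proof.
move=> C0 hphi inj hfg [M hM]; exists (C * M) => s us sS.
apply: (@le_trans _ _ (C * \sum_(j <- map phi s) g j)).
  rewrite big_map mulr_sumr big_seq [leRHS]big_seq; apply: ler_sum => i /sS Si.
  exact: hfg.
rewrite ler_wpM2l // hM //.
  by rewrite map_inj_in_uniq // => i i' /sS Si /sS Si'; exact: inj.
by move=> j /mapP[i /sS Si ->]; exact: hphi.
Qed.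

(** A finite set of pairs lies in the product of its two projections. *)
Lemma summable_onX (I J : eqType) (S : set I) (S' : set J) f g :
  (forall i, 0 <= f i) -> (forall j, 0 <= g j) ->
  summable_on S f -> summable_on S' g ->
  summable_on (S `*` S') (fun ij => f ij.1 * g ij.2).
Proof.
move=> f0 g0 [M hM] [M' hM']; exists (M * M') => s us sS.
pose s1 := undup (map fst s); pose s2 := undup (map snd s).
apply: (@le_trans _ _ (\sum_(ij <- [seq (i, j) | i <- s1, j <- s2]) f ij.1 * g ij.2)).
  apply: ler_sum_subset => //.
  - by move=> ij; rewrite mulr_ge0.
  - by apply: allpairs_uniq; rewrite ?undup_uniq // => -[? ?] [? ?].
  - move=> [i j] ijs; apply/allpairsP; exists (i, j); rewrite /= !mem_undup; split=> //.
      by apply/mapP; exists (i, j).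
    by apply/mapP; exists (i, j).
rewrite big_allpairs_dep /=.
under eq_bigr do rewrite -mulr_sumr.
rewrite -mulr_suml ler_pM ?sumr_ge0 // ?hM ?hM' ?undup_uniq //.
  by move=> i; rewrite mem_undup => /mapP[ij /sS[? ?] ->].
by move=> i; rewrite mem_undup => /mapP[ij /sS[? ?] ->].
Qed.

(* Splitting the terms by parity gives A <= 1 + 2^(1-s) A for the partial sum A. *)
Lemma summable_nat (s : R) : 1 < s ->
  summable_on setT (fun n : nat => (Num.max 1 n%:R) `^ (- s)).
Proof.
move=> s1; have s0 : 0 < s by rewrite (lt_trans ltr01).
pose a (n : nat) : R := n.+1%:R `^ (- s).
have a0 n : 0 <= a n by exact: powR_ge0.
pose h : R := 2 `^ (- s).
have h0 : 0 < h by rewrite powR_gt0.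
have h2 : 2 * h < 1.
  rewrite -[X in X * h]powRr1 // /h -powR_gt0D // -opprB powRN invf_lt1 ?powR_gt0 //.
  have := @gt0_ltr_powR R (s - 1) _ 1 2; rewrite powR1.
  by apply; rewrite ?nnegrE ?subr_gt0 ?ltr1n.
have ha n : a (n.*2).+1 <= h * a n /\ a (n.*2).+2 <= h * a n.
  have E : h * a n = (n.+1.*2)%:R `^ (- s).
    by rewrite /h /a -powRM // -natrM mul2n.
  by rewrite E; split; rewrite /a; apply: le_powRN2r;
    rewrite ?(ltW s0) ?ltr0n // ler_nat doubleS // leqW.
have bound N : \sum_(0 <= n < N) a n <= (1 - 2 * h)^-1.
  have dbl : \sum_(0 <= n < (N.*2).+1) a n <= 1 + 2 * h * \sum_(0 <= n < N) a n.
    elim: N => [|N IH]; first by rewrite big_nat1 big_geq // mulr0 addr0 /a powR1.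
    rewrite doubleS big_nat_recr //= big_nat_recr //= [in leRHS]big_nat_recr //=.
    by have [h1 h3] := ha N; lra.
  have : \sum_(0 <= n < N) a n <= \sum_(0 <= n < (N.*2).+1) a n.
    have NN : (N <= (N.*2).+1)%N by rewrite -addnn leqW // leq_addr.
    by rewrite [leRHS](big_cat_nat (leq0n N) NN) /= lerDl sumr_ge0.
  move=> le1; rewrite -[leRHS]mul1r ler_pdivlMr; last by rewrite subr_gt0.
  by move: (le_trans le1 dbl); set S := \sum_(0 <= n < N) a n; lra.
exists (1 + (1 - 2 * h)^-1) => t ut _.
have [N hN] : exists N, forall n, n \in t -> (n < N)%N.
  by exists (\max_(n <- t) n).+1 => n nt; rewrite ltnS leq_bigmax_seq.
apply: (@le_trans _ _ (\sum_(n <- iota 0 N.+1) (Num.max 1 n%:R) `^ (- s))).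
  apply: ler_sum_subset; rewrite ?iota_uniq // => n nt.
  by rewrite mem_iota add0n leqW ?hN.
rewrite /= big_cons maxEle ler10 /= powR1 lerD2l (iotaDl 1 0) big_map.
apply: le_trans (bound N); rewrite /index_iota subn0 le_eqVlt; apply/orP; left; apply/eqP.
by apply: eq_bigr => n _; rewrite maxEle add1n ler1n.
Qed.

Lemma summable_int (s : R) : 1 < s ->
  summable_on setT (fun m : int => (Num.max 1 `|m%:~R|) `^ (- s)).
Proof.
move=> s1; have [M hM] := summable_nat s1; exists (M + M) => t ut _.
rewrite (bigID (fun m : int => 0 <= m)) /=.
have E (m : int) : (Num.max 1 `|m%:~R|) `^ (- s) = (Num.max 1 (absz m)%:R) `^ (- s) :> R.
  by rewrite -intr_norm -abszE.
have part (P : pred int) : {in P &, injective absz} ->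
    \sum_(m <- t | P m) (Num.max 1 `|m%:~R|) `^ (- s) <= M.
  move=> inj; rewrite -big_filter; under eq_bigr do rewrite E.
  rewrite -(big_map absz xpredT (fun n : nat => (Num.max 1 n%:R) `^ (- s))).
  apply: hM => //; rewrite map_inj_in_uniq ?filter_uniq // => m n.
  by rewrite !mem_filter => /andP[Pm _] /andP[Pn _]; exact: inj.
apply: lerD; apply: part => m n; rewrite !unfold_in /=.
  by move=> m0 n0 e; rewrite -(gez0_abs m0) -(gez0_abs n0) e.
rewrite -!ltNge => m0 n0 e.
by apply: oppr_inj; rewrite -(ltz0_abs m0) -(ltz0_abs n0) e.
Qed.

End SummableOn.

(** * Sums of negative powers over O_K *)

Section SummableRing.
Variables (R : realType) (d : nat).
Hypothesis d0 : (0 < d)%N.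

(** The maximum with 1 counts the element 0 with weight 1 in sums of negative powers. *)
Definition height (x : R[i]) : R := Num.max 1 (cmod x).

Lemma height_ge1 x : 1 <= height x. Proof. by rewrite le_max lexx. Qed.
Lemma height_gt0 x : 0 < height x.
Proof. exact: lt_le_trans ltr01 (height_ge1 x). Qed.

(** An injection into pairs of integers, linearly bounded by the height: O_K has rank 2 over the
    integers. *)
Lemma ringOK_code : exists code : R[i] -> int * int,
  (forall x y, ringOK d x -> ringOK d y -> code x = code y -> x = y) /\
  exists2 k : R, 0 < k & forall x, ringOK d x ->
    Num.max 1 `|(code x).1%:~R| <= k * height x /\
    Num.max 1 `|(code x).2%:~R| <= k * height x.
Proof.
pose rd : R := Num.sqrt d%:R.
have rd0 : 0 < rd by rewrite sqrtr_gt0 ltr0n.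
pose elt (mn : int * int) : R[i] := (mn.1%:~R / 2) +i* (mn.2%:~R / (2 * rd)).
have /choice[code hcode] : forall x, exists mn, ringOK d x -> x = elt mn.
  move=> x; have [rx|nrx] := pselect (ringOK d x); last by exists (0, 0).
  by have [m [n ->]] := ringOK_coord d0 rx; exists (m, n).
exists code; split.
  by move=> x y rx ry e; rewrite (hcode _ rx) (hcode _ ry) e.
pose k := 2 + 2 * rd.
have k0 : 0 < k by rewrite addr_gt0 // mulr_gt0.
have k1 : 1 <= k by rewrite /k; lra.
exists k => // x rx; have xE := hcode x rx.
have Re_x : `|(code x).1%:~R| <= 2 * cmod x.
  rewrite mulrC -ler_pdivrMr // -[X in _ / X]gtr0_norm // -normf_div.
  by apply: le_trans (Re_le_cmod x); rewrite {2}xE.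
have Im_x : `|(code x).2%:~R| <= 2 * rd * cmod x.
  rewrite mulrC -ler_pdivrMr ?mulr_gt0 // -[X in _ / X]gtr0_norm ?mulr_gt0 // -normf_div.
  by apply: le_trans (Im_le_cmod x); rewrite {2}xE.
have kh : 1 <= k * height x by rewrite -[leLHS]mulr1 ler_pM // height_ge1.
have ch : cmod x <= height x by rewrite le_max lexx orbT.
rewrite !ge_max kh /=; split.
  rewrite (le_trans Re_x) // ler_pM ?cmod_ge0 // /k; lra.
rewrite (le_trans Im_x) // ler_pM ?cmod_ge0 ?mulr_ge0 ?(ltW rd0) // /k; lra.
Qed.

Lemma countable_ringOK : countable [set x : R[i] | ringOK d x].
Proof.
have [code [inj _]] := ringOK_code.
apply/countable_injP; exists (fun x => pickle (code x)) => x y.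
rewrite !inE => rx ry /(pcan_inj pickleK); exact: inj.
Qed.

(** Each integer coordinate receives half of the exponent, and the sum over the integers converges
    for s / 2 > 1. *)
Lemma summable_ringOK (s : R) : 2 < s ->
  summable_on [set x : R[i] | ringOK d x] (fun x => height x `^ (- s)).
Proof.
move=> s2; have [code [inj [k k0 hk]]] := ringOK_code.
have s1 : 1 < s / 2 by rewrite ltr_pdivlMr // mul1r.
have s0 : 0 <= s / 2 by rewrite (le_trans _ (ltW s1)).
have sumZ := summable_int s1.
have W0 (m : int) : 0 <= (Num.max 1 `|m%:~R| : R) `^ (- (s / 2)) by exact: powR_ge0.
apply: (summable_on_inj (phi := code) (C := (k `^ (- (s / 2))) ^- 2) _ _ _ _
  (summable_onX W0 W0 sumZ sumZ)) => //.
  by rewrite invr_ge0 exprn_ge0 // powR_ge0.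
move=> x rx; have [h1 h2] := hk x rx.
have step (y : R) : Num.max 1 y <= k * height x ->
    height x `^ (- (s / 2)) <= (k `^ (- (s / 2)))^-1 * (Num.max 1 y) `^ (- (s / 2)).
  move=> hy; rewrite ler_pdivlMl ?powR_gt0 //.
  rewrite -powRM ?(ltW k0) ?(ltW (height_gt0 _)) //.
  by apply: le_powRN2r => //; rewrite lt_max ltr01.
have -> : - s = - (s / 2) + - (s / 2) by field.
rewrite powR_gt0D ?height_gt0 // -exprVn expr2 mulrACA.
by apply: ler_pM; rewrite ?powR_ge0 // step.
Qed.

End SummableRing.

(** * The Borel-Cantelli lemma for countable families *)

Section BorelCantelli.
Context (disp : measure_display) (T : measurableType disp) (R : realType).
Variables (mu : {measure set T -> \bar R}) (G : eqType) (S : set G) (A : G -> set T).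
Hypothesis cS : countable S.
Hypothesis mA : forall g, measurable (A g).

(** Gaps in the enumeration let finite and infinite S be treated alike; each element has exactly one
    index, so sums over indices are sums over S. *)
Lemma countable_enum : exists h : nat -> option G,
  (forall n g, h n = Some g -> S g) /\
  (forall g, S g -> exists n, h n = Some g) /\
  (forall n n' g, h n = Some g -> h n' = Some g -> n = n').
Proof.
have /countable_injP[e einj] := cS.
have /choice[h hh] : forall n, exists o : option G,
    match o with Some g => S g /\ e g = n | None => forall g, S g -> e g <> n end.
  move=> n; have [[g [Sg eg]]|H] := pselect (exists g, S g /\ e g = n).
    by exists (Some g).
  by exists None => g Sg eg; apply: H; exists g.
exists h; split; [|split].
- by move=> n g hn; have := hh n; rewrite hn => -[].
- move=> g Sg; exists (e g); have := hh (e g); case: (h (e g)) => [g'|/(_ _ Sg)//].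
  by move=> [Sg' eg]; congr Some; apply: einj; rewrite ?inE.
- by move=> n n' g hn hn'; have := hh n; have := hh n'; rewrite hn hn' => -[_ ->] [_ ->].
Qed.

Lemma negligible_bigcup_countable : (forall g, S g -> mu (A g) = 0%E) ->
  mu.-negligible [set x | exists2 g, S g & A g x].
Proof.
move=> A0; have [h [hS [hex _]]] := countable_enum.
pose B n := if h n is Some g then A g else set0.
have : mu.-negligible (\bigcup_n B n).
  apply: negligible_bigcup => n; rewrite /B; case E: (h n) => [g|]; last exact: negligible_set0.
  by exists (A g); split=> //; apply: A0; exact: hS E.
apply: negligibleS => x [g Sg Agx]; have [n hn] := hex _ Sg.
by exists n => //; rewrite /B hn.
Qed.

Lemma borel_cantelli (f : G -> R) : (forall g, 0 <= f g) ->
  (forall g, S g -> (mu (A g) <= (f g)%:E)%E) -> summable_on S f ->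
  mu.-negligible [set x | infinite_set [set g | S g /\ A g x]].
Proof.
move=> f0 Af [M hM]; have [h [hS [hex hinj]]] := countable_enum.
pose B n := if h n is Some g then A g else set0.
pose w n := if h n is Some g then f g else 0.
have mB n : measurable (B n) by rewrite /B; case: (h n).
have Bw n : (mu (B n) <= (w n)%:E)%E.
  rewrite /B /w; case E: (h n) => [g|]; last by rewrite measure0.
  exact: Af (hS _ _ E).
have wM N : \sum_(0 <= n < N) w n <= M.
  have [s [us hs ->]] : exists s, [/\ uniq s,
      (forall g, g \in s -> S g /\ exists2 n, (n < N)%N & h n = Some g) &
      \sum_(0 <= n < N) w n = \sum_(g <- s) f g].
    elim: N => [|N [s [us hs IH]]]; first by exists [::]; rewrite big_geq // big_nil.
    rewrite big_nat_recr //= IH /w; case E: (h N) => [g|]; last first.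
      exists s; rewrite addr0; split=> // g /hs[Sg [n nN hn]]; split=> //.
      by exists n => //; rewrite ltnW.
    exists (g :: s); rewrite big_cons addrC; split=> //=.
      rewrite us andbT; apply/negP => /hs[_ [n nN hn]].
      by rewrite (hinj _ _ _ hn E) ltnn in nN.
    move=> g'; rewrite inE => /orP[/eqP ->|/hs[Sg [n nN hn]]].
      by split; [exact: hS E | exists N].
    by split=> //; exists n => //; rewrite ltnW.
  by apply: hM => // g /hs[].
have sumB : (\sum_(n <oo) mu (B n) < +oo)%E.
  apply: (@le_lt_trans _ _ M%:E); last exact: ltry.
  apply: lime_le; first exact: is_cvg_nneseries.
  apply: nearW => N; apply: (@le_trans _ _ (\sum_(0 <= n < N) (w n)%:E)%E).
    by apply: lee_sum.
  by rewrite sumEFin lee_fin wM.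
exists (lim_sup_set B); split.
- by apply: bigcap_measurable => // k _; exact: bigcup_measurable.
- exact: lim_sup_set_cvg0.
(* If x missed every [B n] with n >= N, all g with x in [A g] would have an index below N, hence be
   finite in number. *)
move=> x /= hinf N _; apply: contrapT => hN; have [g0 _] := infinite_setN0 hinf.
apply: hinf; apply: (@sub_finite_set _ _ ((odflt g0 \o h) @` `I_N)); last first.
  by apply: finite_image; exact: finite_II.
move=> g /= [Sg Agx]; have [n hn] := hex _ Sg; exists n => /=; last by rewrite hn.
by rewrite ltnNge; apply/negP => Nn; apply: hN; exists n => //; rewrite /B hn.
Qed.

End BorelCantelli.

(** * Boxes in R^4 and their measure *)

Section Boxes.
Variable R : realType.
Local Notation T4 := (measurableTypeR R * measurableTypeR R *
  measurableTypeR R * measurableTypeR R)%type.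
Implicit Types (a b e : R) (v : 'cV[R[i]]_2).

Definition itv_around a e : set (measurableTypeR R) := `[a - e, a + e].

Lemma itv_aroundE a e b : itv_around a e b = (`|b - a| <= e) :> Prop.
Proof. by rewrite /itv_around /= in_itv /= ler_distl. Qed.

Lemma measurable_itv_around a e : measurable (itv_around a e).
Proof. exact: measurable_itv. Qed.

Lemma lebesgue_itv_around a e : 0 <= e ->
  @lebesgue_measure R (itv_around a e) = (2 * e)%:E.
Proof.
move=> e0; rewrite /itv_around lebesgue_measure_itv /= lte_fin.
have [h|h] := ltP (a - e) (a + e); first by rewrite -EFinB; congr (_%:E); ring.
have -> : e = 0 by apply/eqP; rewrite eq_le e0 andbT; lra.
by rewrite mulr0.
Qed.

Definition box v e : set T4 :=
  itv_around (complex.Re (v 0 0)) e `*` itv_around (complex.Im (v 0 0)) e `*`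
  itv_around (complex.Re (v 1 0)) e `*` itv_around (complex.Im (v 1 0)) e.

Lemma measurable_box v e : measurable (box v e).
Proof.
by apply: measurableX; [apply: measurableX; [apply: measurableX|]|];
  exact: measurable_itv_around.
Qed.

Lemma lebR4_setX (A B C D : set (measurableTypeR R)) :
  measurable A -> measurable B -> measurable C -> measurable D ->
  lebR4 R (A `*` B `*` C `*` D) = (@lebesgue_measure R A * @lebesgue_measure R B *
    @lebesgue_measure R C * @lebesgue_measure R D)%E.
Proof.
move=> mA mB mC mD.
have mAB := measurableX mA mB; have mABC := measurableX mAB mC.
have H := @product_measure1E _ _ _ _ R (@lebesgue_measure R \x @lebesgue_measure R \x
   @lebesgue_measure R)%E (@lebesgue_measure R) _ _ mABC mD.
rewrite [LHS]H.
have H2 := @product_measure1E _ _ _ _ R (@lebesgue_measure R \x @lebesgue_measure R)%E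
   (@lebesgue_measure R) _ _ mAB mC.
rewrite [X in (X * _)%E]H2.
have H3 := @product_measure1E _ _ _ _ R (@lebesgue_measure R) (@lebesgue_measure R) _ _ mA mB.
by rewrite [X in (X * _ * _)%E]H3.
Qed.

Lemma measure_box v e : 0 <= e -> lebR4 R (box v e) = ((2 * e) ^+ 4)%:E.
Proof.
move=> e0; have m := measurable_itv_around.
rewrite /box lebR4_setX //.
by rewrite !lebesgue_itv_around // -!EFinM; congr (_%:E); ring.
Qed.

Lemma vecC2E (x1 x2 x3 x4 : R) :
  (vecC2 (x1, x2, x3, x4) 0 0 = x1 +i* x2) * (vecC2 (x1, x2, x3, x4) 1 0 = x3 +i* x4).
Proof. by rewrite !mxE. Qed.

Lemma in_box v e (x : T4) : max_norm (v - vecC2 x) <= e -> box v e x.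
Proof.
case: x => [[[x1 x2] x3] x4] h.
have hi i := le_trans (max_norm_ge (v - vecC2 (x1, x2, x3, x4)) i 0) h.
have Re_h i : `|complex.Re ((v - vecC2 (x1, x2, x3, x4)) i 0)| <= e.
  exact: le_trans (Re_le_cmod _) (hi i).
have Im_h i : `|complex.Im ((v - vecC2 (x1, x2, x3, x4)) i 0)| <= e.
  exact: le_trans (Im_le_cmod _) (hi i).
have E (u u' : R[i]) : (complex.Re (u - u') = complex.Re u - complex.Re u') *
   (complex.Im (u - u') = complex.Im u - complex.Im u').
  by case: u => ? ?; case: u' => ? ?.
have sub i : (v - vecC2 (x1, x2, x3, x4)) i 0 = v i 0 - vecC2 (x1, x2, x3, x4) i 0.
  by rewrite mxE [X in _ + X = _]mxE.
rewrite /box; do !split; rewrite /= itv_aroundE distrC.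
- by have := Re_h 0; rewrite sub E vecC2E.
- by have := Im_h 0; rewrite sub E vecC2E.
- by have := Re_h 1; rewrite sub E vecC2E.
- by have := Im_h 1; rewrite sub E vecC2E.
Qed.

End Boxes.

(** * Bounding a product measure by its sections *)

Section Slices.
Local Open Scope ereal_scope.

Lemma product_measure_le_ysection d1 d2 (T1 : measurableType d1) (T2 : measurableType d2)
    (R : realType) (m1 : {sigma_finite_measure set T1 -> \bar R})
    (m2 : {sigma_finite_measure set T2 -> \bar R})
    (A : set (T1 * T2)) (B : set T2) (c : R) :
  measurable A -> measurable B -> (0 <= c)%R -> A `<=` setT `*` B ->
  (forall y, B y -> m1 (ysection A y) <= c%:E) -> (m1 \x m2) A <= c%:E * m2 B.
Proof.
move=> mA mB c0 AB h.
(* The product measure is defined by integrating x-sections; uniqueness allows the y-sections of the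
   hypothesis instead. *)
have -> : (m1 \x m2) A = (m1 \x^ m2) A.
  by apply: product_measure_unique => // C D mC mD; exact: product_measure2E.
rewrite /product_measure2.
apply: (@le_trans _ _ (\int[m2]_y (c%:E * (\1_B y)%:E))).
  apply: ge0_le_integral => //.
  - exact: measurable_fun_ysection.
  - by apply: measurable_funeM; exact: measurableT_comp.
  move=> y _ /=; rewrite indicE; have [yB|yB] := boolP (y \in B).
    by rewrite mule1; apply: h; rewrite inE in yB.
  rewrite mule0; suff -> : ysection A y = set0 by rewrite measure0.
  apply/seteqP; split=> // x; rewrite /ysection /= inE => /AB[_ /= By].
  by move: yB; rewrite notin_setE.
rewrite ge0_integralZl //; last exact: measurableT_comp.
by rewrite integral_indic // setIT.
Qed.

End Slices.

(** * Neighbourhoods of complex lines *)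

Section Slabs.
Variable R : realType.
Local Notation T1 := (measurableTypeR R).
Local Notation T4 := (T1 * T1 * T1 * T1)%type.
Implicit Types (N e r s : R).

(** In complex terms y_2 is bounded by N and y_1 - (r + i s) y_2 by e, each for real and imaginary
    parts separately: a neighbourhood of the line of slope r + i s. *)
Definition slab N e r s : set T4 :=
  [set x | [/\ itv_around 0 N x.2, itv_around 0 N x.1.2,
     itv_around (r * x.1.2 - s * x.2) e x.1.1.1 &
     itv_around (r * x.2 + s * x.1.2) e x.1.1.2]].

Lemma measurable_slab N e r s : measurable (slab N e r s).
Proof.
have -> : slab N e r s =
    ((fun x : T4 => x.2) @^-1` itv_around 0 N) `&` ((fun x : T4 => x.1.2) @^-1` itv_around 0 N) `&`
    ((fun x : T4 => x.1.1.1 - (r * x.1.2 - s * x.2)) @^-1` itv_around 0 e) `&`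
    ((fun x : T4 => x.1.1.2 - (r * x.2 + s * x.1.2)) @^-1` itv_around 0 e).
  apply/seteqP; split=> x; rewrite /slab /= !itv_aroundE.
    by move=> [? ? h1 h2]; do !split=> //; rewrite subr0.
  by rewrite !subr0 => -[[[? ?] ?] ?]; split.
have m1 : measurable_fun setT (fun x : T4 => x.1.1.1).
  exact: (measurableT_comp measurable_fst (measurableT_comp measurable_fst measurable_fst)).
have m2 : measurable_fun setT (fun x : T4 => x.1.1.2).
  exact: (measurableT_comp measurable_snd (measurableT_comp measurable_fst measurable_fst)).
have m3 : measurable_fun setT (fun x : T4 => x.1.2).
  exact: (measurableT_comp measurable_snd measurable_fst).
have m4 : measurable_fun setT (fun x : T4 => x.2) by exact: measurable_snd.
have pre (f : T4 -> T1) a b : measurable_fun setT f -> measurable (f @^-1` itv_around a b).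
  by move=> mf; rewrite -[X in measurable X]setTI; apply: mf => //; exact: measurable_itv_around.
apply: measurableI; [apply: measurableI; [apply: measurableI|]|]; apply: pre => //.
  by apply: measurable_funB => //; apply: measurable_funB; exact: measurable_funM.
by apply: measurable_funB => //; apply: measurable_funD; exact: measurable_funM.
Qed.

Local Notation l1 := (@lebesgue_measure R).

Lemma itv_around_cover (t : R) : exists n0 : nat, forall n, (n0 <= n)%N ->
  itv_around 0 n%:R t.
Proof.
exists (Num.truncn `|t|).+1 => n h; rewrite itv_aroundE subr0 ltW //.
by rewrite (lt_le_trans (truncnS_gt _)) // ler_nat.
Qed.

(* The library's sigma-finiteness instance for products is shadowed by the one
   for subprobabilities, hence these copies of the product measures. *)
Definition leb2 : set (T1 * T1)%type -> \bar R := (l1 \x l1)%E.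
HB.instance Definition _ := Measure.on leb2.

Lemma leb2_setX (A B : set T1) : measurable A -> measurable B ->
  leb2 (A `*` B) = (l1 A * l1 B)%E.
Proof. by move=> mA mB; exact: (product_measure1E _ _ mA mB). Qed.

Lemma leb2_sigma_finite : sigma_finite setT leb2.
Proof.
exists (fun n => itv_around 0 n%:R `*` itv_around 0 n%:R).
  apply/seteqP; split=> // -[x1 x2] _.
  have [n1 h1] := itv_around_cover x1; have [n2 h2] := itv_around_cover x2.
  by exists (maxn n1 n2) => //; split; [apply: h1; rewrite leq_maxl | apply: h2; rewrite leq_maxr].
move=> n; have m := measurable_itv_around (0 : R) n%:R; split; first exact: measurableX.
by rewrite leb2_setX // !lebesgue_itv_around // -EFinM ltry.
Qed.
HB.instance Definition _ := Measure_isSigmaFinite.Build _ _ _ leb2 leb2_sigma_finite.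

Definition leb3 : set (T1 * T1 * T1)%type -> \bar R := (leb2 \x l1)%E.
HB.instance Definition _ := Measure.on leb3.

Lemma leb3_setX (A : set (T1 * T1)%type) (B : set T1) : measurable A -> measurable B ->
  leb3 (A `*` B) = (leb2 A * l1 B)%E.
Proof. by move=> mA mB; exact: (product_measure1E _ _ mA mB). Qed.

Lemma leb3_sigma_finite : sigma_finite setT leb3.
Proof.
exists (fun n => itv_around 0 n%:R `*` itv_around 0 n%:R `*` itv_around 0 n%:R).
  apply/seteqP; split=> // -[[x1 x2] x3] _.
  have [n1 h1] := itv_around_cover x1; have [n2 h2] := itv_around_cover x2.
  have [n3 h3] := itv_around_cover x3.
  exists (maxn (maxn n1 n2) n3) => //; split; last by apply: h3; rewrite leq_maxr.
  by split; [apply: h1 | apply: h2]; rewrite !leq_max leqnn ?orbT.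
move=> n; have m := measurable_itv_around (0 : R) n%:R.
have m2 := measurableX m m; split; first exact: measurableX.
by rewrite leb3_setX // leb2_setX // !lebesgue_itv_around // -!EFinM ltry.
Qed.
HB.instance Definition _ := Measure_isSigmaFinite.Build _ _ _ leb3 leb3_sigma_finite.

(** For fixed y_2 the section is a square of side 2 e, whose area does not depend on its centre. Its
    two real coordinates are sliced off one after the other. *)
Lemma measure_slab N e r s : 0 <= N -> 0 <= e ->
  (lebR4 R (slab N e r s) <= ((2 * e) ^+ 2 * (2 * N) ^+ 2)%:E)%E.
Proof.
move=> N0 e0.
have mb := @measurable_itv_around R.
have mS := measurable_slab N e r s.
have e20 : 0 <= (2 * e) ^+ 2 by rewrite exprn_ge0 // mulr_ge0.
have c0 : 0 <= (2 * e) ^+ 2 * (2 * N) by rewrite !mulr_ge0.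
have lN : l1 (itv_around 0 N) = (2 * N)%:E by exact: lebesgue_itv_around.
have H4 := @product_measure_le_ysection _ _ _ _ R leb3 l1
  (slab N e r s) (itv_around 0 N) _ mS (mb _ _) c0.
have -> : (((2 * e) ^+ 2 * (2 * N) ^+ 2)%:E =
   ((2 * e) ^+ 2 * (2 * N))%:E * l1 (itv_around 0 N))%E.
  by rewrite lN -EFinM; congr (_%:E); ring.
apply: H4; first by move=> x [].
move=> x4 hx4.
have mS4 : measurable (ysection (slab N e r s) x4) by exact: measurable_ysection.
have H3 := @product_measure_le_ysection _ _ _ _ R leb2 l1
  (ysection (slab N e r s) x4) (itv_around 0 N) _ mS4 (mb _ _) e20.
have -> : (((2 * e) ^+ 2 * (2 * N))%:E =
   ((2 * e) ^+ 2)%:E * l1 (itv_around 0 N))%E by rewrite lN -EFinM.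
apply: H3; first by move=> x; rewrite /ysection /= inE => -[].
move=> x3 hx3.
have -> : ysection (ysection (slab N e r s) x4) x3 =
    itv_around (r * x3 - s * x4) e `*` itv_around (r * x4 + s * x3) e.
  apply/seteqP; split=> -[x1 x2]; rewrite /ysection /= !inE /= inE /slab /=.
    by move=> [].
  by move=> [h1 h2]; split.
have := leb2_setX (mb (r * x3 - s * x4) e) (mb (r * x4 + s * x3) e).
by rewrite !lebesgue_itv_around // -EFinM -expr2 => H; rewrite [leLHS]H.
Qed.

End Slabs.

(** * Almost every vector has a generic slope *)

Section AlmostEverywhereGeneric.
Variables (R : realType) (d : nat) (hd : d \in [:: 1; 3; 7; 11]%N).
Hypothesis hconv : has_convergents R d.
Local Notation T4 := (measurableTypeR R * measurableTypeR R *
  measurableTypeR R * measurableTypeR R)%type.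

Lemma omegaK_ge1 (xi : R[i]) : ~ quadK d xi -> (1%:E <= omegaK d xi)%E.
Proof.
move=> Kxi; have [C [p [q [C0 cpq]]]] := hconv Kxi.
apply/lee_addgt0Pr => e e0; rewrite -leeBlDr // -EFinB.
apply: ereal_sup_ubound; exists (1 - e) => //= fin.
(* On a finite set of solutions a positive lower bound for (1 + |q|)^(-1) bounds |q| from above. A
   far convergent exceeds it and is a solution, as |q|^e absorbs the constant C. *)
have [|c c0 hc] := finite_set_pos_min
  (f := fun pq : R[i] * R[i] => (1 + cmod pq.2)^-1) fin.
  by move=> pq _; rewrite invr_gt0 ltr_pwDl // cmod_ge0.
pose M := Num.max (c^-1) (C `^ e^-1).
pose n := (Num.truncn (M ^+ 2)).+1.
have M0 : 0 <= M by rewrite le_max invr_ge0 (ltW c0).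
have [[rp rq q1 qS] [_ hn qn]] := cpq n.
have Mq : M < cmod (q n).
  rewrite -(@ltr_pXn2r _ 2) ?nnegrE ?cmod_ge0 //.
  by rewrite (lt_le_trans (truncnS_gt _)).
have q0 : 0 < cmod (q n) := lt_le_trans ltr01 q1.
have /hc /= : [set pq : R[i] * R[i] | [/\ ringOK d pq.1, ringOK d pq.2, pq.2 != 0 &
    cmod (pq.2 * xi - pq.1) <= cmod pq.2 `^ (- (1 - e))]] (p n, q n).
  split=> //; first by rewrite -cmod_gt0.
  rewrite (le_trans hn) // opprB addrC powR_gt0D // powR_inv1 ?(ltW q0) //.
  have Cq : C <= cmod (q n) `^ e.
    rewrite -[C](powRVK C0 (lt0r_neq0 e0)) le_powR2r ?powR_ge0 ?(ltW e0) //.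
    by rewrite (le_trans _ (ltW Mq)) // le_max lexx orbT.
  rewrite mulrC ler_pM ?invr_ge0 ?(ltW C0) ?cmod_ge0 //.
  by rewrite lef_pV2 ?posrE ?(ltW qS) // (lt_trans q0).
rewrite leNgt => /negP; apply.
rewrite -[ltRHS]invrK ltf_pV2 ?posrE ?invr_gt0 ?ltr_pwDl ?cmod_ge0 //.
have : c^-1 <= M by rewrite le_max lexx.
lra.
Qed.

Definition close_fraction (N : R) (pq : R[i] * R[i]) : Prop :=
  [/\ ringOK d pq.1, ringOK d pq.2, pq.2 != 0 & cmod pq.1 <= N * cmod pq.2].

Definition fraction_slab (N w : R) (pq : R[i] * R[i]) : set T4 :=
  slab N (N * cmod pq.2 `^ (- (1 + w)))
    (complex.Re (pq.1 / pq.2)) (complex.Im (pq.1 / pq.2)).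

Lemma in_fraction_slab N w pq (x : T4) :
  cmod (vecC2 x 1 0) <= N ->
  cmod (vecC2 x 0 0 - pq.1 / pq.2 * vecC2 x 1 0) <= N * cmod pq.2 `^ (- (1 + w)) ->
  fraction_slab N w pq x.
Proof.
case: x => [[[x1 x2] x3] x4]; rewrite !vecC2E => zN h.
have := le_trans (Re_le_cmod _) h; have := le_trans (Im_le_cmod _) h.
have := le_trans (Re_le_cmod _) zN; have := le_trans (Im_le_cmod _) zN.
rewrite /fraction_slab /slab /=; case: (pq.1 / pq.2) => r s /= h4 h3 h2 h1.
by rewrite !itv_aroundE !subr0.
Qed.

(** The bound |p| <= N |q| trades one factor |q|^(-s) for N^s times a factor in the height of p,
    which leaves a product of two sums over O_K. *)
Lemma summable_close_fraction (N s : R) : 1 <= N -> 2 < s ->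
  summable_on (close_fraction N) (fun pq => cmod pq.2 `^ (- s) * cmod pq.2 `^ (- s)).
Proof.
move=> N1 s2; have N0 : 0 < N := lt_le_trans ltr01 N1.
have s0 : 0 <= s by rewrite (le_trans _ (ltW s2)).
have sumO := summable_ringOK (discriminant_gt0 hd) s2.
have W0 (x : R[i]) : 0 <= height x `^ (- s) by exact: powR_ge0.
apply: (summable_on_inj (phi := id) (C := N `^ s) _ _ _ _
  (summable_onX W0 W0 sumO sumO)) => //; first exact: powR_ge0.
  by move=> [p q] [].
move=> [p q] [/= rp rq q0 pN].
have q1 := ringOK_cmod_ge1 rq q0.
have hq : height q = cmod q by rewrite /height; apply/max_idPr.
rewrite hq mulrA ler_wpM2r ?powR_ge0 //.
have qpos : 0 < cmod q := lt_le_trans ltr01 q1.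
rewrite -(ler_pM2l (powR_gt0 (- s) N0)) mulrA -powR_gt0D // addNr powRr0 mul1r.
rewrite -powRM ?(ltW N0) ?(ltW qpos) // le_powRN2r ?height_gt0 //.
by rewrite /height ge_max pN andbT -[leLHS]mulr1 ler_pM.
Qed.

(** The slab of p / q has measure at most 16 N^4 |q|^(-2 (1+w)), and 1 + w > 2 makes this
    summable. *)
Lemma negligible_fraction_slabs (N w : R) : 1 <= N -> 1 < w ->
  (lebR4 R).-negligible
    [set x | infinite_set [set pq | close_fraction N pq /\ fraction_slab N w pq x]].
Proof.
move=> N1 w1; have N0 : 0 <= N by rewrite (le_trans ler01).
have [s sE] : {s | s = 1 + w} by exists (1 + w).
have s2 : 2 < s by rewrite sE; lra.
have [M hM] := summable_close_fraction N1 s2.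
apply: (@borel_cantelli _ _ _ _ _ _ _ _ _
  (fun pq => 16 * N ^+ 4 * (cmod pq.2 `^ (- s) * cmod pq.2 `^ (- s)))).
- apply: (@sub_countable _ _ _ ([set x : R[i] | ringOK d x] `*` [set x : R[i] | ringOK d x])).
    by apply: subset_card_le => -[p q] [].
  by apply: countableX; exact: (countable_ringOK R (discriminant_gt0 hd)).
- by move=> pq; exact: measurable_slab.
- by move=> pq; rewrite !mulr_ge0 ?exprn_ge0 ?powR_ge0.
- move=> pq _; rewrite /fraction_slab.
  apply: le_trans (measure_slab _ _ N0 _) _; first by rewrite mulr_ge0 ?powR_ge0.
  by rewrite lee_fin le_eqVlt -sE; apply/orP; left; apply/eqP; ring.
- exists (16 * N ^+ 4 * M) => t ut tS; rewrite -mulr_sumr.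
  by rewrite ler_wpM2l ?mulr_ge0 ?exprn_ge0 // hM.
Qed.

(** Either the slope is in K or omega_K exceeds 1. The excess is quantised as 1 / (m + 1) and every
    large N is allowed, so that the exceptional vectors form a countable union of null sets. *)
Lemma not_generic_infinite (v : 'cV[R[i]]_2) : v 1 0 != 0 -> ~ generic_slope d v ->
  exists m : nat, forall N : R, cmod (slope v) + 1 <= N -> cmod (v 1 0) <= N ->
  infinite_set [set pq : R[i] * R[i] | close_fraction N pq /\
    cmod (v 0 0 - pq.1 / pq.2 * v 1 0) <= N * cmod pq.2 `^ (- (1 + (1 + m.+1%:R^-1)))].
Proof.
move=> v1 ng.
have vE (x : R[i]) : v 0 0 - x * v 1 0 = v 1 0 * (slope v - x).
  by rewrite /slope; field.
have [Kv|Kv] := pselect (quadK d (slope v)).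
  have [p [q [rp rq q0 E]]] := quadK_fracP Kv.
  (* p / q is hit by all the pairs (n p, n q). *)
  exists 0%N => N hN hN' fin.
  have natOK (n : nat) : ringOK d (n%:R : R[i]) by exact: (ringOK_int _ _ (n : int)).
  pose f (n : nat) : R[i] * R[i] := (n.+1%:R * p, n.+1%:R * q).
  have n0 (n : nat) : n.+1%:R != 0 :> R[i] by rewrite pnatr_eq0.
  apply: infinite_nat.
  suff <- : f @^-1` [set pq : R[i] * R[i] | close_fraction N pq /\
    cmod (v 0 0 - pq.1 / pq.2 * v 1 0) <= N * cmod pq.2 `^ (- (1 + (1 + 1%:R^-1)))] = setT.
    apply: finite_preimage fin => n m _ _ [_ /(mulIf q0)/eqP].
    by rewrite eqr_nat eqSS => /eqP.
  have N0 : 0 <= N by rewrite (le_trans _ hN) // addr_ge0 ?cmod_ge0.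
  apply/seteqP; split=> // n _; rewrite /f /=; split.
    split=> /=; [exact: ringOKM | exact: ringOKM | by rewrite mulf_neq0 |].
    rewrite !cmodM mulrCA ler_wpM2l ?cmod_ge0 //.
    have -> : p = slope v * q by rewrite E divfK.
    by rewrite cmodM ler_wpM2r ?cmod_ge0 // (le_trans _ hN) // lerDl.
  have -> : n.+1%:R * p / (n.+1%:R * q) = slope v.
    by rewrite E; field; rewrite q0 addrC natr1 n0.
  by rewrite vE subrr mulr0 cmod0 mulr_ge0 ?powR_ge0.
have [w w1 hw] : exists2 w : R, 1 < w & infinite_set [set pq : R[i] * R[i] |
    [/\ ringOK d pq.1, ringOK d pq.2, pq.2 != 0 &
     cmod (pq.2 * slope v - pq.1) <= cmod pq.2 `^ (- w)]].
  apply: contrapT => H; apply: ng; split=> //; apply/eqP; rewrite eq_le omegaK_ge1 // andbT.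
  apply: ge_ereal_sup => _ [w hw <-]; rewrite lee_fin leNgt; apply/negP => w1.
  by apply: H; exists w.
have [m hm] : exists m : nat, m.+1%:R^-1 <= w - 1.
  exists (Num.truncn (w - 1)^-1); rewrite -[leRHS]invrK lef_pV2 ?posrE ?invr_gt0 ?subr_gt0 //.
  by rewrite ltW // truncnS_gt.
exists m => N hN hN'; apply: contra_not hw; apply: sub_finite_set => -[p q] /= [rp rq q0 h].
have q1 := ringOK_cmod_ge1 rq q0; have qpos := lt_le_trans ltr01 q1.
split.
  split=> //=; rewrite -[p](subKr (q * slope v)) (le_trans (cmodD _ _)) // cmodN cmodM.
  apply: (@le_trans _ _ ((cmod (slope v) + 1) * cmod q)); last by rewrite ler_wpM2r ?cmod_ge0.
  rewrite mulrDl mul1r mulrC lerD2l (le_trans h) //.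
  apply: (@le_trans _ _ (cmod q `^ 0)); last by rewrite powRr0.
  by rewrite ler_powR //; lra.
have -> : v 0 0 - p / q * v 1 0 = v 1 0 * (q^-1 * (q * slope v - p)).
  by rewrite vE; field.
rewrite cmodM ler_pM ?cmod_ge0 // cmodM cmodV.
rewrite (le_trans (ler_wpM2l _ h)) ?invr_ge0 ?cmod_ge0 //.
rewrite -powR_inv1 ?cmod_ge0 // -powR_gt0D // ler_powR //.
by move: hm; move: (_^-1) => u hu; lra.
Qed.

Lemma ae_generic_slope : ae_C2 (fun v : 'cV[R[i]]_2 => generic_slope d v).
Proof.
pose bad (k m : nat) : set T4 := [set x | infinite_set [set pq |
  close_fraction k.+1%:R pq /\ fraction_slab k.+1%:R (1 + m.+1%:R^-1) pq x]].
(* The null hyperplane x4 = 0 contains all vectors with second coordinate 0. *)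
pose z0 : set T4 := setT `*` setT `*` setT `*` [set 0].
have nz0 : (lebR4 R).-negligible z0.
  exists z0; split=> //.
    by apply: measurableX => //; apply: measurableX => //; exact: measurableX.
  rewrite /z0 lebR4_setX //.
  by rewrite lebesgue_measure_set1 mule0.
have nbad : (lebR4 R).-negligible (\bigcup_k \bigcup_m bad k m).
  apply: negligible_bigcup => k; apply: negligible_bigcup => m.
  by apply: negligible_fraction_slabs; rewrite ?ler1n // ltrDl invr_gt0 ltr0Sn.
apply: (negligibleS _ (negligibleU nz0 nbad)) => x /= ngx.
have [x0|x0] := eqVneq (vecC2 x 1 0) 0.
  left; move: x0; case: x {ngx} => [[[x1 x2] x3] x4].
  by rewrite vecC2E => -[_ ->].
right; have [m hm] := not_generic_infinite x0 ngx.
pose B := cmod (slope (vecC2 x)) + 1 + cmod (vecC2 x 1 0).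
have hB : B <= (Num.truncn B).+1%:R by rewrite ltW // truncnS_gt.
exists (Num.truncn B) => //; exists m => //.
have c0 := cmod_ge0 (slope (vecC2 x)); have c1 := cmod_ge0 (vecC2 x 1 0).
have N1 : cmod (slope (vecC2 x)) + 1 <= (Num.truncn B).+1%:R.
  by rewrite (le_trans _ hB) // /B lerDl.
have N2 : cmod (vecC2 x 1 0) <= (Num.truncn B).+1%:R.
  by rewrite (le_trans _ hB) // /B lerDr addr_ge0.
apply: contra_not (hm _ N1 N2); apply: sub_finite_set => pq [hpq h].
by split=> //; exact: in_fraction_slab.
Qed.

End AlmostEverywhereGeneric.

(** * Counting the matrices that keep z bounded *)

Section BoundedOrbit.
Variables (R : realType) (d : nat) (hd : d \in [:: 1; 3; 7; 11]%N).
Variables (z : 'cV[R[i]]_2) (z1 : z 1 0 != 0) (N : R) (N0 : 0 <= N).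
Implicit Types g : 'M[R[i]]_2.

Definition bounded_orbit : set 'M[R[i]]_2 :=
  [set g | SL2OK d g /\ max_norm (g *m z) <= N].

Let sqnorm g : R := cmod (g 1 0) ^+ 2 + cmod (g 1 1) ^+ 2.

(** Squared norms are natural numbers, so a shortest second row exists. It serves as a base point
    depending only on the first row, from which the other second rows are reached by multiples of
    that row. *)
Lemma shortest_completion : exists v0 : R[i] * R[i] -> 'M[R[i]]_2,
  forall g, bounded_orbit g -> let h := v0 (g 0 0, g 0 1) in
    [/\ SL2OK d h, h 0 0 = g 0 0, h 0 1 = g 0 1 & sqnorm h <= sqnorm g].
Proof.
have sq_nat g : SL2OK d g -> exists k : nat, sqnorm g = k%:R.
  move=> [rg _]; have [k kE] := ringOK_cmod_sqr (rg 1 0).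
  have [l lE] := ringOK_cmod_sqr (rg 1 1).
  by exists (k + l)%N; rewrite /sqnorm kE lE natrD.
have /choice[v0 hv0] : forall u : R[i] * R[i], exists h, forall g, bounded_orbit g ->
    (g 0 0, g 0 1) = u ->
    [/\ SL2OK d h, h 0 0 = u.1, h 0 1 = u.2 & sqnorm h <= sqnorm g].
  move=> u; pose P (k : nat) := `[< exists g, [/\ bounded_orbit g, (g 0 0, g 0 1) = u &
    sqnorm g = k%:R] >].
  have [exP|noP] := pselect (exists k, P k); last first.
    exists 0 => g bg gu; have [k kE] := sq_nat _ bg.1.
    by exfalso; apply: noP; exists k; apply/asboolP; exists g.
  case: (ex_minnP exP) => k /asboolP[h [[hh _] hu hk]] mink.
  exists h => g bg gu; rewrite -hu; split=> //.
  have [l lE] := sq_nat _ bg.1; rewrite hk lE ler_nat; apply: mink.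
  by apply/asboolP; exists g.
by exists v0 => g bg /=; have := hv0 _ g bg erefl.
Qed.

(** The multiplier is the determinant of the two second rows; this explicit form shows that it lies
    in O_K. *)
Lemma SL2OK_same_row g h : SL2OK d g -> SL2OK d h -> h 0 0 = g 0 0 -> h 0 1 = g 0 1 ->
  let n := g 1 0 * h 1 1 - g 1 1 * h 1 0 in
  g 1 0 - h 1 0 = n * g 0 0 /\ g 1 1 - h 1 1 = n * g 0 1.
Proof.
move=> /SL2OK_det dg /SL2OK_det dh e0 e1 n; rewrite e0 e1 in dh.
have E : g 0 0 * (g 1 1 - h 1 1) = g 0 1 * (g 1 0 - h 1 0).
  apply/eqP; rewrite -subr_eq0; apply/eqP; transitivity ((1 : R[i]) - 1).
    by rewrite -{1}dg -dh; ring.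
  by rewrite subrr.
split; rewrite -[LHS]mulr1 -[X in _ * X]dh /n.
  transitivity ((g 1 0 - h 1 0) * h 1 1 * g 0 0 - h 1 0 * (g 0 1 * (g 1 0 - h 1 0))).
    by ring.
  by rewrite -E; ring.
transitivity (h 1 1 * (g 0 0 * (g 1 1 - h 1 1)) - (g 1 1 - h 1 1) * h 1 0 * g 0 1).
  by ring.
by rewrite E; ring.
Qed.

Lemma countable_bounded_orbit : countable bounded_orbit.
Proof.
have cO := countable_ringOK R (discriminant_gt0 hd).
pose f (t : R[i] * R[i] * R[i] * R[i]) := mat2 t.1.1.1 t.1.1.2 t.1.2 t.2.
pose O := [set x : R[i] | ringOK d x].
apply: (@sub_countable _ _ _ (f @` (O `*` O `*` O `*` O))).
  apply: subset_card_le => g [[rg _] _].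
  exists (g 0 0, g 0 1, g 1 0, g 1 1); last by rewrite /f /= -mat2_eta.
  by split; [split; [split|]|]; exact: rg.
apply: (sub_countable (card_image_le _ _)).
by do 3!(apply: countableX => //).
Qed.

(* With v0 the shortest second row, |n u| <= |v| + |v0| is O(|g|); the entry g 0 1 is within
   a bounded distance of - (g 0 0) * slope z. *)
Lemma summable_bounded_orbit (s : R) : 2 < s ->
  summable_on bounded_orbit (fun g => max_norm g `^ (- s)).
Proof.
move=> s2; have s0 : 0 <= s by rewrite (le_trans _ (ltW s2)).
have sumO := summable_ringOK (discriminant_gt0 hd) s2.
have W0 (x : R[i]) : 0 <= height x `^ (- s) by exact: powR_ge0.
have W0' (x : R[i] * R[i]) : 0 <= height x.1 `^ (- s) * height x.2 `^ (- s).
  by rewrite mulr_ge0.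
have sum3 := summable_onX W0' W0 (summable_onX W0 W0 sumO sumO) sumO.
have [v0 hv0] := shortest_completion.
have /choice[rho hrho] : forall a : R[i], exists n,
    ringOK d n /\ cmod (- (a * slope z) - n) < 1.
  by move=> a; exact: ringOK_euclid.
pose nn g := g 1 0 * (v0 (g 0 0, g 0 1)) 1 1 - g 1 1 * (v0 (g 0 0, g 0 1)) 1 0.
(* These three elements of O_K determine g. Their heights multiply to at most 3 K |g|: the middle
   one is at most K, the outer two together at most 3 |g|. So |g|^(-s) is dominated by a product of
   three summable factors. *)
pose phi g := (g 0 0, g 0 1 - rho (g 0 0), nn g).
have [Z ZE] : {Z | Z = cmod (z 1 0)} by exists (cmod (z 1 0)).
have Z0 : 0 < Z by rewrite ZE cmod_gt0.
pose K := N / Z + 2.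
have NZ0 : 0 <= N / Z by rewrite divr_ge0 // ltW.
have K0 : 0 < K by rewrite ltr_wpDl.
apply: (summable_on_inj (phi := phi) (C := (3 * K) `^ s) _ _ _ _ sum3).
- exact: powR_ge0.
- move=> g bg; have [[rg _] _] := bg; have [[rh _] _ _ _] := hv0 g bg.
  split; [split=> //=|rewrite /=].
    by apply: ringOKB => //; exact: (hrho _).1.
  by apply: ringOKB; exact: ringOKM.
- move=> g g' bg bg' [ea eb en].
  have {}eb : g 0 1 = g' 0 1 by move: eb; rewrite ea => /addIr.
  have [hh h0 h1 _] := hv0 g bg.
  have [hh' h0' h1' _] := hv0 g' bg'.
  have [n0 n1] := SL2OK_same_row bg.1 hh h0 h1.
  have [n0' n1'] := SL2OK_same_row bg'.1 hh' h0' h1'.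
  rewrite -/(nn g) in n0 n1; rewrite -/(nn g') in n0' n1'.
  rewrite (mat2_eta g) (mat2_eta g') ea eb.
  rewrite -[g 1 0](subrK (v0 (g 0 0, g 0 1) 1 0)) -[g 1 1](subrK (v0 (g 0 0, g 0 1) 1 1)).
  rewrite -[g' 1 0](subrK (v0 (g' 0 0, g' 0 1) 1 0)) -[g' 1 1](subrK (v0 (g' 0 0, g' 0 1) 1 1)).
  by rewrite n0 n1 n0' n1' en ea eb.
move=> g bg; have [hg gzN] := bg; have [rg _] := hg; have [hh h0 h1 hsq] := hv0 g bg.
rewrite [phi g]/phi /=.
have [B BE] : {B | B = max_norm g} by exists (max_norm g).
have B1 : 1 <= B by rewrite BE (SL2OK_norm_ge1 hg).
have B0 : 0 < B := lt_le_trans ltr01 B1.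
have gB i j : cmod (g i j) <= B by rewrite BE max_norm_ge.
rewrite -BE.
have hb : height (g 0 1 - rho (g 0 0)) <= K.
  rewrite /height ge_max; apply/andP; split; first by rewrite /K; lra.
  have -> : g 0 1 - rho (g 0 0) =
      (g 0 0 * slope z + g 0 1) + (- (g 0 0 * slope z) - rho (g 0 0)) by ring.
  rewrite (le_trans (cmodD _ _)) // /K.
  have : cmod (g 0 0 * slope z + g 0 1) <= N / Z.
    rewrite ler_pdivlMr // ZE -cmodM mulrC.
    have -> : z 1 0 * (g 0 0 * slope z + g 0 1) = (g *m z) 0 0.
      by rewrite mulmx2E /slope; field.
    exact: le_trans (max_norm_ge _ _ _) gzN.
  by have := (hrho (g 0 0)).2; lra.
have v0B j : cmod (v0 (g 0 0, g 0 1) 1 j) <= 2 * B.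
  have sqB : sqnorm g <= (2 * B) ^+ 2.
    have q0 : cmod (g 1 0) ^+ 2 <= B ^+ 2 by rewrite ler_pXn2r ?nnegrE ?cmod_ge0 ?(ltW B0).
    have q1 : cmod (g 1 1) ^+ 2 <= B ^+ 2 by rewrite ler_pXn2r ?nnegrE ?cmod_ge0 ?(ltW B0).
    by have := sqr_ge0 B; rewrite /sqnorm exprMn; lra.
  have := le_trans hsq sqB; rewrite /sqnorm => hle.
  have hj : cmod (v0 (g 0 0, g 0 1) 1 j) ^+ 2 <= (2 * B) ^+ 2.
    apply: le_trans hle; move: j; apply: ord2P; first by rewrite lerDl sqr_ge0.
    by rewrite lerDr sqr_ge0.
  by rewrite -(@ler_pXn2r _ 2) ?nnegrE ?cmod_ge0 // mulr_ge0 // ltW.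
have [n0 n1] := SL2OK_same_row hg hh h0 h1.
rewrite -/(nn g) in n0 n1.
have hn : height (g 0 0) * height (nn g) <= 3 * B.
  (* Take j = 0 if [g 0 0] is nonzero and j = 1 otherwise. The difference of second rows is at most
     |g| + 2 |g|, which is where 3 comes from. *)
  have core j : height (g 0 0) <= cmod (g 0 j) ->
      g 1 j - v0 (g 0 0, g 0 1) 1 j = nn g * g 0 j ->
      height (g 0 0) * height (nn g) <= 3 * B.
    move=> ha E; rewrite {2}/height maxEle; case: ifP => _; last first.
      by rewrite mulr1 (le_trans ha) // (le_trans (gB _ _)) //; lra.
    rewrite (le_trans (ler_wpM2r (cmod_ge0 _) ha)) // -cmodM mulrC -E.
    rewrite (le_trans (cmodD _ _)) // cmodN.
    by have := gB 1 j; have := v0B j; lra.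
  have [a0|a0] := eqVneq (g 0 0) 0.
    apply: (core 1) => //; rewrite /height a0 cmod0 ge_max cmod_ge0 andbT.
    apply: ringOK_cmod_ge1 => //; apply: contra (SL2OK_row0_neq0 hg) => /eqP b0.
    by rewrite a0 b0.
  apply: (core 0) => //; rewrite /height ge_max lexx andbT.
  exact: ringOK_cmod_ge1.
have h30 : 0 < 3 * K by rewrite mulr_gt0.
have hB : height (g 0 0) * height (g 0 1 - rho (g 0 0)) * height (nn g) <= 3 * K * B.
  rewrite mulrAC; have -> : 3 * K * B = 3 * B * K by ring.
  by rewrite ler_pM // ?mulr_ge0 // ltW // height_gt0.
have hpos : 0 < height (g 0 0) * height (g 0 1 - rho (g 0 0)) * height (nn g).
  by rewrite !mulr_gt0 // height_gt0.
rewrite -!powRM ?mulr_ge0 ?(ltW (height_gt0 _)) //.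
rewrite -(ler_pM2l (powR_gt0 (- s) h30)) mulrA -powR_gt0D // addNr powRr0 mul1r.
by rewrite -powRM ?(ltW h30) ?(ltW B0) // le_powRN2r.
Qed.

(** The box has measure 16 |g|^(-4 w), and 4 w > 2 is the range of convergence found above. *)
Lemma negligible_infinitely_close (w : R) : 2^-1 < w ->
  (lebR4 R).-negligible [set x | infinite_set
    [set g | bounded_orbit g /\ box (g *m z) (max_norm g `^ (- w)) x]].
Proof.
move=> w2; have s2 : 2 < 4 * w by lra.
have [M hM] := summable_bounded_orbit s2.
apply: (@borel_cantelli _ _ _ _ _ _ _ _ _ (fun g => 16 * max_norm g `^ (- (4 * w)))).
- exact: countable_bounded_orbit.
- by move=> g; exact: measurable_box.
- by move=> g; rewrite mulr_ge0 ?powR_ge0.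
- move=> g _; rewrite [leLHS]measure_box ?powR_ge0 // lee_fin exprMn.
  rewrite -[X in _ * X <= _]powR_mulrn ?powR_ge0 // -powRrM mulNr (mulrC w).
  by rewrite ler_wpM2r ?powR_ge0 // -natrX.
- exists (16 * M) => t ut tS; rewrite -mulr_sumr.
  by rewrite ler_wpM2l // hM.
Qed.

End BoundedOrbit.

(** * Almost every target: exponent at most 1/2, and off the orbit *)

Section AlmostEveryTarget.
Variables (R : realType) (d : nat) (hd : d \in [:: 1; 3; 7; 11]%N).
Variables (z : 'cV[R[i]]_2) (z1 : z 1 0 != 0).
Local Notation T4 := (measurableTypeR R * measurableTypeR R *
  measurableTypeR R * measurableTypeR R)%type.

Lemma ae_muG_le_half : ae_C2 (fun y : 'cV[R[i]]_2 => (muG d z y <= (2^-1)%:E)%E).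
Proof.
pose bad (k m : nat) : set T4 := [set x | infinite_set [set g |
  bounded_orbit d z k%:R g /\ box (g *m z) (max_norm g `^ (- (2^-1 + m.+1%:R^-1))) x]].
have nbad : (lebR4 R).-negligible (\bigcup_k \bigcup_m bad k m).
  apply: negligible_bigcup => k; apply: negligible_bigcup => m.
  by apply: negligible_infinitely_close; rewrite // ltrDl invr_gt0 ltr0Sn.
apply: negligibleS nbad => x /= hx.
have [w w2 hw] : exists2 w, 2^-1 < w & infinite_set (mu_solutions d z (vecC2 x) w).
  apply: contrapT => H; apply: hx; apply: muG_le => w w2.
  by apply: contrapT => hinf; apply: H; exists w.
have [m hm] : exists m : nat, m.+1%:R^-1 <= w - 2^-1.
  exists (Num.truncn (w - 2^-1)^-1).
  rewrite -[leRHS]invrK lef_pV2 ?posrE ?invr_gt0 ?subr_gt0 //.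
  by rewrite ltW // truncnS_gt.
(* As |g| >= 1, every solution g satisfies |g z| <= |y| + |g|^(-w) <= |y| + 1, so it belongs to one
   bounded orbit. *)
pose B := max_norm (vecC2 x) + 1.
exists (Num.truncn B).+1 => //; exists m => //.
apply: contra_not hw; apply: sub_finite_set => g [hg h].
have g1 := SL2OK_norm_ge1 hg.
have w0 : 2^-1 + m.+1%:R^-1 <= w by move: hm; rewrite lerBrDl.
split; last first.
  by apply: in_box; rewrite (le_trans h) // ler_powR // lerN2.
split=> //; rewrite -[g *m z](subrK (vecC2 x)) (le_trans (max_normD _ _)) //.
apply: (@le_trans _ _ B); last by rewrite ltW // truncnS_gt.
rewrite /B addrC lerD2l (le_trans h) //.
by rewrite -(powRr0 (max_norm g)) ler_powR // oppr_le0 (le_trans _ (ltW w2)).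
Qed.

(** The orbit is a countable union of points, each a box of radius 0. *)
Lemma ae_not_in_orbit :
  ae_C2 (fun y : 'cV[R[i]]_2 => forall g, SL2OK d g -> g *m z != y).
Proof.
have n0 : (lebR4 R).-negligible (\bigcup_(k in [set: nat])
    [set x : T4 | exists2 g, bounded_orbit d z k%:R g & box (g *m z) 0 x]).
  apply: negligible_bigcup => k; apply: negligible_bigcup_countable.
  - exact: countable_bounded_orbit.
  - by move=> g; exact: measurable_box.
  - by move=> g _; rewrite [LHS]measure_box // mulr0 expr0n.
apply: negligibleS n0 => x /= /existsNP[g /not_implyP[hg /negP]]; rewrite negbK => /eqP gx.
exists (Num.truncn (max_norm (g *m z))).+1 => //; exists g.
  by split=> //; rewrite ltW // truncnS_gt.
apply: in_box; rewrite gx subrr; apply: max_norm_le => // i j.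
by rewrite mxE cmod0.
Qed.

End AlmostEveryTarget.

Theorem theorem1p4 (R : realType) (d : nat) (hd : d \in [:: 1; 3; 7; 11]%N)
  (hcf : exists (a : R[i] -> nat -> R[i]) (r0 : nat) (theta : R),
    [/\ cf_algorithm d a, 1 < theta &
        forall z : R[i], ~ quadK d z ->
          \forall n \near \oo,
            cmod (cf_den (a z) n) < cmod (cf_den (a z) n.+1) /\
            theta * cmod (cf_den (a z) n) <= cmod (cf_den (a z) (n + r0)%N)]) :
  ae_C2 (fun z : 'cV[R[i]]_2 => generic_slope d z) /\
  (forall z : 'cV[R[i]]_2, generic_slope d z ->
    [/\ muG d z 0 = 1%:E /\ hat_muG d z 0 = 1%:E,
        ae_C2 (fun y : 'cV[R[i]]_2 => generic_slope d y ->
          [/\ ((3%:R^-1)%:E <= hat_muG d z y)%E,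
              (hat_muG d z y <= muG d z y)%E &
              (muG d z y <= (2%:R^-1)%:E)%E]) &
        forall y : 'cV[R[i]]_2, y 1 0 != 0 -> quadK d (slope y) ->
          muG d z y = (2%:R^-1)%:E /\ hat_muG d z y = (2%:R^-1)%:E]).
Proof.
case: hcf => a [r0 [theta [cfa th growth]]].
have hconv := has_convergents_of_cf cfa th growth.
split; first exact: ae_generic_slope.
move=> z gz; have z1 := generic_coord_neq0 gz; split.
- have hat1 := hat_muG_ge ltr01 (fun w => hat_approximable_zero hd hconv gz (w := w)).
  have mu1 : (muG d z 0 <= 1%:E)%E by apply: muG_le => w; exact: mu_zero_finite.
  have w01 : 0 < (2^-1 : R) < 1 by apply/andP; split; lra.
  have hm : (hat_muG d z 0 <= muG d z 0)%E.
    apply: (hat_muG_le_muG (w0 := 2^-1)) => //.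
      exact: (hat_approximable_zero hd hconv gz w01).
    by move=> g; exact: mulmx_generic_neq0.
  split; apply/eqP; rewrite eq_le.
    by rewrite mu1 (le_trans hat1 hm).
  by rewrite hat1 (le_trans hm mu1).
- have n1 : (lebR4 R).-negligible (~` [set x | (muG d z (vecC2 x) <= (2^-1)%:E)%E]).
    exact: (ae_muG_le_half hd z1).
  have n2 : (lebR4 R).-negligible (~` [set x | forall g, SL2OK d g -> g *m z != vecC2 x]).
    exact: (ae_not_in_orbit hd).
  apply: negligibleS (negligibleU n1 n2) => x /= hx.
  have [mux|] := pselect (muG d z (vecC2 x) <= (2^-1)%:E)%E; last by left.
  right => hit; apply: hx => gy.
  have hat3 : ((3^-1)%:E <= hat_muG d z (vecC2 x))%E.
    by apply: hat_muG_ge => // w; exact: hat_approximable_generic.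
  have w01 : 0 < (4^-1 : R) < 3^-1 by apply/andP; split; lra.
  split=> //; apply: (hat_muG_le_muG (w0 := 4^-1)) => //.
  exact: (hat_approximable_generic hd hconv gz gy w01).
- move=> y y1 Ky.
  have hat2 : ((2^-1)%:E <= hat_muG d z y)%E.
    by apply: hat_muG_ge => // w; exact: hat_approximable_quadK.
  have mu2 : (muG d z y <= (2^-1)%:E)%E.
    by apply: muG_le => w; exact: mu_quadK_finite.
  have w01 : 0 < (4^-1 : R) < 2^-1 by apply/andP; split; lra.
  have hm : (hat_muG d z y <= muG d z y)%E.
    apply: (hat_muG_le_muG (w0 := 4^-1)) => //.
      exact: (hat_approximable_quadK hd hconv gz y1 Ky w01).
    by move=> g; exact: mulmx_quadK_neq.
  split; apply/eqP; rewrite eq_le.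
    by rewrite mu2 (le_trans hat2 hm).
  by rewrite hat2 (le_trans hm mu2).
Qed.
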